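(* Let $f:[0,1]\to[0,1]$ be an $S$-unimodal map which is only finitely renormalizable and whose critical point $c$ is recurrent and not periodic. Then there exist $\delta>0$ and a sequence of nice points $y_n\in\mathcal N$ such that for every $n$ the interval $V_{y_n}$ contains a $\delta$-scaled neighborhood of $U_{y_n}$ (i.e. $(U_{y_n},V_{y_n})$ is a $\delta$-transfer range), and $|V_{y_n}|\to0$.
   Context: $f$ is $S$-unimodal: a smooth ($C^3$) map of $[0,1]$ with $f(0)=f(1)=0$, unique turning point $c$, negative Schwarzian derivative away from $c$, and non-flat critical point. For $y\in[0,1]$, $\tau(y)$ is the point with $f(\tau(y))=f(y)$, $\tau(y)\ne y$ (and $\tau(c)=c$). For $x\ne c$, $V_x$ is the open interval between $x$ and $\tau(x)$; $x$ is nice if $f^n(x)\notin V_x$ for all $n\ge0$, and $\mathcal N$ is the set of nice points. The first return map $R_x$ of $V_x$ is $R_x(y)=f^{k}(y)$ for $y\in V_x$, where $k\ge1$ is minimal with $f^k(y)\in V_x$ (defined where such $k$ exists); $U_x$ is the component of the domain of $R_x$ containing $c$. An interval $V$ contains a $\delta$-scaled neighborhood of an interval $U\subset V$ if both components of $V\setminus U$ have length at least $\delta|U|$. A $\delta$-transfer range is a pair $(U_x,V_x)$, $x\in\mathcal N$, with $V_x$ containing a $\delta$-scaled neighborhood of $U_x$. *)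

(* Defs.v *)
From Stdlib Require Import Reals.
From Coquelicot Require Import Coquelicot.
Open Scope R_scope.

Definition itr (f : R -> R) (n : nat) (x : R) : R := Nat.iter n f x.

Definition C3_on (P : R -> Prop) (g : R -> R) : Prop :=
  forall x, P x ->
    (forall k, (k <= 3)%nat -> ex_derive_n g k x) /\ continuous (Derive_n g 3) x.

Definition apow (t alpha : R) : R :=
  if Req_EM_T t 0 then 0 else Rpower (Rabs t) alpha.

(* Non-flat critical point (de Melo - van Strien): near c,
   f(x) = f(c) - |phi(x)|^alpha with phi a C^3 diffeomorphism, phi(c)=0, alpha>1.
   (The sign is "-" since c is the maximum of f.) *)
Definition nonflat_crit (f : R -> R) (c : R) : Prop :=
  exists (eps alpha : R) (phi : R -> R),
    0 < eps /\ 1 < alpha /\ phi c = 0 /\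
    C3_on (fun x => c - eps < x < c + eps) phi /\
    (forall x, c - eps < x < c + eps -> Derive phi x <> 0) /\
    (forall x, c - eps < x < c + eps -> f x = f c - apow (phi x) alpha).

Definition schwarzian (f : R -> R) (x : R) : R :=
  Derive_n f 3 x / Derive f x - 3 / 2 * (Derive_n f 2 x / Derive f x) ^ 2.

Definition S_unimodal (f : R -> R) (c : R) : Prop :=
  (forall x, 0 <= x <= 1 -> 0 <= f x <= 1) /\
  C3_on (fun x => 0 <= x <= 1) f /\
  f 0 = 0 /\ f 1 = 0 /\
  0 < c < 1 /\
  (forall x y, 0 <= x -> x < y -> y <= c -> f x < f y) /\
  (forall x y, c <= x -> x < y -> y <= 1 -> f y < f x) /\
  (forall x, 0 <= x <= 1 -> x <> c -> Derive f x <> 0 /\ schwarzian f x < 0) /\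
  nonflat_crit f c.

Definition in_image (f : R -> R) (i : nat) (a b y : R) : Prop :=
  exists x, a <= x <= b /\ itr f i x = y.

(* [a,b] is a restrictive interval of period p: c in its interior, p >= 2,
   f^p maps [a,b] into itself and its boundary into its boundary, and the
   interiors of f^i([a,b]), 0 <= i < p, are pairwise disjoint (the images are
   intervals, so disjoint interiors = no common nondegenerate interval). *)
Definition restrictive (f : R -> R) (c : R) (p : nat) (a b : R) : Prop :=
  (2 <= p)%nat /\ 0 <= a /\ a < c /\ c < b /\ b <= 1 /\
  (forall x, a <= x <= b -> a <= itr f p x <= b) /\
  (itr f p a = a \/ itr f p a = b) /\ (itr f p b = a \/ itr f p b = b) /\
  (forall i j, (i < j)%nat -> (j < p)%nat ->
     ~ exists u v, u < v /\
        (forall y, u < y < v -> in_image f i a b y /\ in_image f j a b y)).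

Definition renormalizable_with_period (f : R -> R) (c : R) (p : nat) : Prop :=
  exists a b, restrictive f c p a b.

(* only finitely renormalizable: periods of renormalizations are bounded
   (includes the non-renormalizable case). *)
Definition finitely_renormalizable (f : R -> R) (c : R) : Prop :=
  exists N : nat, forall p, renormalizable_with_period f c p -> (p <= N)%nat.

Definition recurrent (f : R -> R) (c : R) : Prop :=
  forall eps, 0 < eps -> forall N : nat, exists n, (N < n)%nat /\ Rabs (itr f n c - c) < eps.

Definition periodic_pt (f : R -> R) (c : R) : Prop :=
  exists n, (1 <= n)%nat /\ itr f n c = c.

Definition is_tau (f : R -> R) (c y t : R) : Prop :=
  0 <= t <= 1 /\ f t = f y /\ (t <> y \/ (y = c /\ t = c)).

Definition V_ (f : R -> R) (c x y : R) : Prop :=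
  exists t, is_tau f c x t /\ Rmin x t < y < Rmax x t.

Definition nice (f : R -> R) (c x : R) : Prop :=
  0 <= x <= 1 /\ x <> c /\ forall n : nat, ~ V_ f c x (itr f n x).

Definition return_dom (f : R -> R) (c x y : R) : Prop :=
  V_ f c x y /\ exists k : nat, (1 <= k)%nat /\ V_ f c x (itr f k y).

(* U_x : connected component of the domain of R_x containing c *)
Definition U_ (f : R -> R) (c x y : R) : Prop :=
  forall z, Rmin c y <= z <= Rmax c y -> return_dom f c x z.

Definition scaled_nbhd (delta : R) (U V : R -> Prop) : Prop :=
  exists a u1 u2 b,
    (forall y, V y <-> a < y < b) /\ (forall y, U y <-> u1 < y < u2) /\
    u1 < u2 /\ delta * (u2 - u1) <= u1 - a /\ delta * (u2 - u1) <= b - u2.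

(* Main.v *)
Require Import Defs.
From Stdlib Require Import Reals.
From Stdlib Require Import Ranalysis5 Lra Lia Wf_nat Compare_dec Classical ClassicalEpsilon.
From Coquelicot Require Import Coquelicot.
Open Scope R_scope.

(* Negative Schwarzian derivative makes every monotone branch of an iterate expand cross
   ratios.  A superlevel set {f > v} is a symmetric interval around c, and it is bounded by
   a nice point exactly when no iterate of v exceeds v, so niceness and first returns can be
   followed on the orbit of the critical value.

   A priori space: for a small nice interval V with first return time r of c, the branch of
   f^(r-1) around f(c) that covers V extends over a definite neighbourhood of V.  If it
   stopped close to V, it would stop at some f^j(c) with j < r, and V would pull back along
   f^j; the Koebe space lemma then shows that the branch around f(c) belonging to f^j stops
   even closer beyond f^j(c), and so on for ever with decreasing j.  The pull-back of V by
   f^j is short because otherwise f^j would map a small interval around c into itself, which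
   gives a renormalization of period j, excluded for large j.

   Finite renormalizability and recurrence give arbitrarily small nice V whose critical
   return f^r(c) lies outside the central domain U.  If U nearly filled V, then either the
   return map folds U into a short interval near the boundary of V, and a larger interval
   is mapped monotonically into itself, so that c would be attracted by a cycle; or the
   image of U covers U, and then the central domain of U itself is definitely smaller than
   U.  Hence one of the two pairs is a transfer range. *)

(** A first return of [c] is one application of [f], which folds, followed by a monotone iterate.
    Cross ratios are therefore compared only around the critical value, and the fold enters only
    through drops [f c - v]. Nested intervals around [c] are compared by the ratio of their drops,
    and the power law turns such a ratio into scaled space with constants depending on [f] alone.

    The descent behind the a priori space cannot control the distance from the image of [c] to the
    interval alone, because each Koebe step may increase it. Hence a second point is marked, and the
    sum of the distances to the interval and to the marked point is followed. A step shrinks the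
    second distance at least by the factor three and enlarges the first by at most the new second
    distance, so the sum does not grow. The slack [/ 9] in the drops yields this factor: the images
    in play have length at most three times that of the interval. *)

(** * Calculus and the cross-ratio inequality *)

Lemma continuity_pt_of_is_derive (F : R -> R) (x d : R) :
  is_derive F x d -> continuity_pt F x.
Proof.
  intros H. apply derivable_continuous_pt. exists d. apply is_derive_Reals, H.
Qed.

Lemma mean_value (F d : R -> R) (a b : R) :
  a < b ->
  (forall x, a <= x <= b -> continuity_pt F x) ->
  (forall x, a < x < b -> is_derive F x (d x)) ->
  exists x, a < x < b /\ F b - F a = d x * (b - a).
Proof.
  intros Hab Hc Hd.
  assert (pr1 : forall x, a < x < b -> derivable_pt F x).
  { intros x Hx. exists (d x). apply is_derive_Reals, Hd, Hx. }
  assert (pr2 : forall x, a < x < b -> derivable_pt id x).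
  { intros x _. apply derivable_pt_id. }
  destruct (MVT F id a b pr1 pr2 Hab Hc) as [x [Hx E]].
  { intros x _. apply derivable_continuous_pt, derivable_pt_id. }
  exists x. split; [exact Hx|].
  assert (E1 : derive_pt F x (pr1 x Hx) = d x).
  { apply derive_pt_eq_0, is_derive_Reals, Hd, Hx. }
  assert (E2 : derive_pt id x (pr2 x Hx) = 1).
  { apply derive_pt_eq_0, derivable_pt_lim_id. }
  rewrite E1, E2 in E. unfold id in E. lra.
Qed.

Lemma nondecreasing_of_derive (F d : R -> R) (a b : R) :
  a <= b ->
  (forall x, a <= x <= b -> continuity_pt F x) ->
  (forall x, a < x < b -> is_derive F x (d x)) ->
  (forall x, a < x < b -> 0 <= d x) ->
  F a <= F b.
Proof.
  intros [Hab| ->] Hc Hd Hp; [|lra].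
  destruct (mean_value F d a b Hab Hc Hd) as [x [Hx E]].
  specialize (Hp x Hx). nra.
Qed.

Lemma increasing_of_derive (F d : R -> R) (a b : R) :
  a < b ->
  (forall x, a <= x <= b -> continuity_pt F x) ->
  (forall x, a < x < b -> is_derive F x (d x)) ->
  (forall x, a < x < b -> 0 < d x) ->
  F a < F b.
Proof.
  intros Hab Hc Hd Hp.
  destruct (mean_value F d a b Hab Hc Hd) as [x [Hx E]].
  specialize (Hp x Hx). nra.
Qed.

Definition schwarz_neg (F D1 D2 D3 : R -> R) (t : R) : Prop :=
  is_derive F t (D1 t) /\ is_derive D1 t (D2 t) /\ is_derive D2 t (D3 t) /\
  0 < D1 t /\ D3 t * D1 t - 3 / 2 * D2 t ^ 2 <= 0.

(* Infinitesimal form of the cross-ratio inequality.  With g = 1/sqrt F', negative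
   Schwarzian means g'' >= 0, and W t = g t (F t - F x) - (t - x) / g x satisfies
   W x = W' x = 0 and W'' = g'' (F - F x) >= 0, hence W >= 0. *)
Lemma two_point_inequality (F D1 D2 D3 : R -> R) (x y : R) :
  x < y ->
  (forall t, x <= t <= y -> schwarz_neg F D1 D2 D3 t) ->
  (y - x) ^ 2 * D1 x * D1 y <= (F y - F x) ^ 2.
Proof.
  intros Hxy H.
  assert (HF : forall t, x <= t <= y -> F x <= F t).
  { intros t Ht. apply (nondecreasing_of_derive F D1); [lra| | |].
    - intros u Hu. apply (continuity_pt_of_is_derive _ _ (D1 u)). apply H; lra.
    - intros u Hu. apply H; lra.
    - intros u Hu. apply Rlt_le. apply H; lra. }
  assert (Hs : forall t, x <= t <= y -> 0 < sqrt (D1 t)).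
  { intros t Ht. apply sqrt_lt_R0. apply H; lra. }
  assert (Hss : forall t, x <= t <= y -> sqrt (D1 t) * sqrt (D1 t) = D1 t).
  { intros t Ht. apply sqrt_sqrt. apply Rlt_le, H; lra. }
  set (W := fun t => (F t - F x) / sqrt (D1 t) - (t - x) * sqrt (D1 x)).
  set (Z := fun t => - / 2 * D2 t * (F t - F x) / sqrt (D1 t) ^ 3
                     + sqrt (D1 t) - sqrt (D1 x)).
  set (Z' := fun t => - / 2 * (D3 t * D1 t - 3 / 2 * D2 t ^ 2) * (F t - F x)
                      / sqrt (D1 t) ^ 5).
  assert (HW : forall t, x <= t <= y -> is_derive W t (Z t)).
  { intros t Ht. destruct (H t Ht) as (H1 & H2 & H3 & H4 & _).
    unfold W, Z. pose proof (Hs t Ht). pose proof (Hss t Ht) as E.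
    auto_derive.
    - repeat split; try (eexists; eassumption); lra.
    - replace (Derive (fun x0 : R => F x0) t)
        with (D1 t) by (symmetry; exact (is_derive_unique _ _ _ H1)).
      replace (Derive (fun x0 : R => D1 x0) t)
        with (D2 t) by (symmetry; exact (is_derive_unique _ _ _ H2)).
      rewrite <- E at 1. field. lra. }
  assert (HZ : forall t, x <= t <= y -> is_derive Z t (Z' t)).
  { intros t Ht. destruct (H t Ht) as (H1 & H2 & H3 & H4 & _).
    unfold Z, Z'. pose proof (Hs t Ht). pose proof (Hss t Ht) as E.
    auto_derive.
    - repeat split; try (eexists; eassumption); try lra.
      apply Rgt_not_eq. repeat apply Rmult_lt_0_compat; lra.
    - replace (Derive (fun x0 : R => F x0) t)
        with (D1 t) by (symmetry; exact (is_derive_unique _ _ _ H1)).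
      replace (Derive (fun x0 : R => D1 x0) t)
        with (D2 t) by (symmetry; exact (is_derive_unique _ _ _ H2)).
      replace (Derive (fun x0 : R => D2 x0) t)
        with (D3 t) by (symmetry; exact (is_derive_unique _ _ _ H3)).
      set (s := sqrt (D1 t)) in *. rewrite <- E. field. lra. }
  assert (Z0 : forall t, x <= t <= y -> 0 <= Z t).
  { intros t Ht.
    assert (E0 : Z x = 0).
    { unfold Z. field. apply Rgt_not_eq, Hs. lra. }
    rewrite <- E0. apply (nondecreasing_of_derive Z Z'); [lra| | |].
    - intros u Hu. apply (continuity_pt_of_is_derive _ _ (Z' u)), HZ. lra.
    - intros u Hu. apply HZ. lra.
    - intros u Hu. unfold Z'. assert (Hu' : x <= u <= y) by lra.
      destruct (H u Hu') as (_ & _ & _ & _ & H5).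
      pose proof (HF u Hu'). pose proof (pow_lt _ 5 (Hs u Hu')).
      apply Rmult_le_pos; [nra|]. apply Rlt_le, Rinv_0_lt_compat. assumption. }
  assert (W0 : W x <= W y).
  { apply (nondecreasing_of_derive W Z); [lra| | |].
    - intros u Hu. apply (continuity_pt_of_is_derive _ _ (Z u)), HW. lra.
    - intros u Hu. apply HW. lra.
    - intros u Hu. apply Z0. lra. }
  assert (Ix : x <= x <= y) by lra. assert (Iy : x <= y <= y) by lra.
  pose proof (Hs x Ix). pose proof (Hs y Iy).
  assert (E0 : W x = 0) by (unfold W; field; lra).
  rewrite E0 in W0. unfold W in W0.
  assert (K : (y - x) * sqrt (D1 x) * sqrt (D1 y) <= F y - F x).
  { replace (F y - F x) with ((F y - F x) / sqrt (D1 y) * sqrt (D1 y)) by (field; lra).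
    apply Rmult_le_compat_r; lra. }
  rewrite <- (Hss x Ix), <- (Hss y Iy).
  replace ((y - x) ^ 2 * (sqrt (D1 x) * sqrt (D1 x)) * (sqrt (D1 y) * sqrt (D1 y)))
    with (((y - x) * sqrt (D1 x) * sqrt (D1 y)) ^ 2) by ring.
  apply pow_incr. split; [|exact K].
  repeat apply Rmult_le_pos; lra.
Qed.

(** The logarithm of [(F y - F x) / (y - x)] has mixed derivative [D1 x * D1 y / (F y - F x) ^ 2 - /
    (y - x) ^ 2], nonpositive by [two_point_inequality]; integrate it over [[p, q]] in [x] and
    [[s, t]] in [y]. Derivatives are required only in the interior, so [p] or [t] may be
    critical. *)
Lemma cross_ratio_increasing (F D1 D2 D3 : R -> R) (p q s t : R) :
  p < q -> q < s -> s < t ->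
  (forall x, p <= x <= t -> continuity_pt F x) ->
  (forall x, p < x < t -> schwarz_neg F D1 D2 D3 x) ->
  (t - p) * (s - q) * ((F s - F p) * (F t - F q))
  <= (F t - F p) * (F s - F q) * ((s - p) * (t - q)).
Proof.
  intros Hpq Hqs Hst Hc H.
  assert (HF : forall x y, p <= x -> x < y -> y <= t -> F x < F y).
  { intros x y Hx Hxy Hy. apply (increasing_of_derive F D1); [lra| | |].
    - intros u Hu. apply Hc. lra.
    - intros u Hu. apply H. lra.
    - intros u Hu. apply H. lra. }
  (* First integration, in [x], with [y] fixed. *)
  assert (K : forall y, s < y < t ->
    D1 y / (F y - F q) - / (y - q) <= D1 y / (F y - F p) - / (y - p)).
  { intros y Hy. apply Ropp_le_cancel.
    set (k := fun x => - (D1 y / (F y - F x) - / (y - x))).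
    set (k' := fun x => - (D1 y * D1 x / (F y - F x) ^ 2 - / (y - x) ^ 2)).
    change (k p <= k q).
    apply (nondecreasing_of_derive k k'); [lra| | |].
    - intros x Hx. pose proof (HF x y ltac:(lra) ltac:(lra) ltac:(lra)).
      assert (C : continuity_pt F x) by (apply Hc; lra).
      unfold k. apply continuity_pt_opp, continuity_pt_minus.
      + apply continuity_pt_mult; [apply continuity_pt_const; intros ? ?; reflexivity|].
        apply continuity_pt_inv; [|lra].
        apply continuity_pt_minus; [apply continuity_pt_const; intros ? ?; reflexivity|exact C].
      + apply continuity_pt_inv; [|lra].
        apply continuity_pt_minus; [apply continuity_pt_const; intros ? ?; reflexivity|].
        apply derivable_continuous_pt, derivable_pt_id.
    - intros x Hx. pose proof (HF x y ltac:(lra) ltac:(lra) ltac:(lra)).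
      destruct (H x ltac:(lra)) as (H1 & _).
      unfold k, k'. auto_derive.
      + repeat split; try (eexists; eassumption); lra.
      + replace (Derive (fun x0 : R => F x0) x)
          with (D1 x) by (symmetry; exact (is_derive_unique _ _ _ H1)). field. lra.
    - intros x Hx. pose proof (HF x y ltac:(lra) ltac:(lra) ltac:(lra)).
      pose proof (two_point_inequality F D1 D2 D3 x y ltac:(lra)
                    ltac:(intros u Hu; apply H; lra)) as T.
      unfold k'.
      assert (D1 y * D1 x / (F y - F x) ^ 2 <= / (y - x) ^ 2); [|lra].
      assert (0 < (F y - F x) ^ 2) by (apply pow_lt; lra).
      assert (0 < (y - x) ^ 2) by (apply pow_lt; lra).
      apply (Rmult_le_reg_r ((F y - F x) ^ 2 * (y - x) ^ 2)); [nra|].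
      replace (D1 y * D1 x / (F y - F x) ^ 2 * ((F y - F x) ^ 2 * (y - x) ^ 2))
        with ((y - x) ^ 2 * D1 x * D1 y) by (field; lra).
      replace (/ (y - x) ^ 2 * ((F y - F x) ^ 2 * (y - x) ^ 2))
        with ((F y - F x) ^ 2) by (field; lra).
      exact T. }
  (* Second integration, in [y]; signs are reversed so that [L] is nondecreasing. *)
  set (L := fun y => - (ln (F y - F q) - ln (F y - F p) - ln (y - q) + ln (y - p))).
  set (L' := fun y => - (D1 y / (F y - F q) - / (y - q)
                         - (D1 y / (F y - F p) - / (y - p)))).
  assert (LL : L s <= L t).
  { apply (nondecreasing_of_derive L L'); [lra| | |].
    - intros y Hy.
      pose proof (HF q y ltac:(lra) ltac:(lra) ltac:(lra)).
      pose proof (HF p y ltac:(lra) ltac:(lra) ltac:(lra)).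
      assert (C : continuity_pt F y) by (apply Hc; lra).
      assert (Cl : forall (G : R -> R) a, continuity_pt G y -> a < G y ->
                 continuity_pt (fun x => ln (G x - a)) y).
      { intros G a CG Ha. apply (continuity_pt_comp (fun x => G x - a) ln).
        - apply continuity_pt_minus; [exact CG|].
          apply continuity_pt_const. intros ? ?. reflexivity.
        - apply derivable_continuous_pt. exists (/ (G y - a)).
          apply derivable_pt_lim_ln. lra. }
      assert (Ci : continuity_pt (fun x => x) y)
        by apply derivable_continuous_pt, derivable_pt_id.
      unfold L. apply continuity_pt_opp, continuity_pt_plus.
      + apply continuity_pt_minus; [apply continuity_pt_minus|].
        * apply (Cl F); [exact C|lra].
        * apply (Cl F); [exact C|lra].
        * apply (Cl (fun x => x)); [exact Ci|lra].
      + apply (Cl (fun x => x)); [exact Ci|lra].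
    - intros y Hy.
      pose proof (HF q y ltac:(lra) ltac:(lra) ltac:(lra)).
      pose proof (HF p y ltac:(lra) ltac:(lra) ltac:(lra)).
      destruct (H y ltac:(lra)) as (HD & _).
      unfold L, L'. auto_derive.
      + repeat split; try (eexists; eassumption); lra.
      + replace (Derive (fun x0 : R => F x0) y)
          with (D1 y) by (symmetry; exact (is_derive_unique _ _ _ HD)). field. lra.
    - intros y Hy. unfold L'. specialize (K y Hy). lra. }
  pose proof (HF p s ltac:(lra) ltac:(lra) ltac:(lra)).
  pose proof (HF q s ltac:(lra) ltac:(lra) ltac:(lra)).
  pose proof (HF p t ltac:(lra) ltac:(lra) ltac:(lra)).
  pose proof (HF q t ltac:(lra) ltac:(lra) ltac:(lra)).
  apply Rnot_lt_le. intros Hlt. unfold L in LL.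
  apply ln_increasing in Hlt; [|repeat apply Rmult_lt_0_compat; lra].
  rewrite !ln_mult in Hlt by (try apply Rmult_lt_0_compat; lra). lra.
Qed.

Lemma ivt (F : R -> R) (a b y : R) :
  a <= b ->
  (forall x, a <= x <= b -> continuity_pt F x) ->
  (F a <= y <= F b \/ F b <= y <= F a) ->
  exists x, a <= x <= b /\ F x = y.
Proof.
  intros Hab Hc Hy.
  destruct (Req_dec (F a) y) as [E|Na]; [exists a; split; [lra|exact E]|].
  destruct (Req_dec (F b) y) as [E|Nb]; [exists b; split; [lra|exact E]|].
  assert (Hlt : a < b).
  { destruct (Req_dec a b) as [E|N]; [subst; lra|lra]. }
  assert (Cc : forall x, continuity_pt (fun _ : R => y) x).
  { intros x. apply continuity_pt_const. intros ? ?. reflexivity. }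
  destruct Hy as [Hy|Hy].
  - destruct (IVT_interv (fun x => F x - y) a b) as [z [Hz E]]; [|exact Hlt|lra|lra|].
    + intros x Hx. apply continuity_pt_minus; [apply Hc; exact Hx|apply Cc].
    + exists z. split; [exact Hz|lra].
  - destruct (IVT_interv (fun x => y - F x) a b) as [z [Hz E]]; [|exact Hlt|lra|lra|].
    + intros x Hx. apply continuity_pt_minus; [apply Cc|apply Hc; exact Hx].
    + exists z. split; [exact Hz|lra].
Qed.

Definition strictly_monotone (F : R -> R) (a b : R) : Prop :=
  (forall x y, a <= x -> x < y -> y <= b -> F x < F y) \/
  (forall x y, a <= x -> x < y -> y <= b -> F y < F x).

Lemma derive_nonneg_of_increasing (F : R -> R) (x d e : R) :
  0 < e -> (forall y, x < y < x + e -> F x <= F y) -> is_derive F x d -> 0 <= d.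
Proof.
  intros He Hi Hd. apply is_derive_Reals in Hd.
  apply Rnot_lt_le. intros Hneg.
  destruct (Hd (- d) ltac:(lra)) as [[delta Hdel] HD]. simpl in HD.
  set (h := Rmin (delta / 2) (e / 2)).
  assert (Hh : 0 < h) by (apply Rmin_glb_lt; lra).
  assert (h <= delta / 2) by apply Rmin_l. assert (h <= e / 2) by apply Rmin_r.
  specialize (HD h ltac:(lra)). rewrite (Rabs_right h) in HD by lra.
  specialize (HD ltac:(lra)). apply Rabs_def2 in HD.
  specialize (Hi (x + h) ltac:(lra)).
  assert (0 <= (F (x + h) - F x) / h).
  { apply Rmult_le_pos; [lra|]. apply Rlt_le, Rinv_0_lt_compat, Hh. }
  lra.
Qed.

(** * Iterates of a unimodal map *)

Section Unimodal.
Context (f : R -> R) (c : R) (Hf : S_unimodal f c).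

Lemma f_range x : 0 <= x <= 1 -> 0 <= f x <= 1.
Proof. apply Hf. Qed.

Lemma f_0 : f 0 = 0. Proof. apply Hf. Qed.
Lemma f_1 : f 1 = 0. Proof. apply Hf. Qed.
Lemma c_range : 0 < c < 1. Proof. apply Hf. Qed.

Lemma f_increasing x y : 0 <= x -> x < y -> y <= c -> f x < f y.
Proof. apply Hf. Qed.

Lemma f_decreasing x y : c <= x -> x < y -> y <= 1 -> f y < f x.
Proof. apply Hf. Qed.

Lemma f_derives x :
  0 <= x <= 1 ->
  is_derive f x (Derive f x) /\ is_derive (Derive f) x (Derive_n f 2 x) /\
  is_derive (Derive_n f 2) x (Derive_n f 3 x).
Proof.
  intros Hx. destruct Hf as (_ & HC & _). destruct (HC x Hx) as [HD _].
  split; [|split].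
  - apply Derive_correct. exact (HD 1%nat ltac:(lia)).
  - apply (Derive_correct (Derive f)). exact (HD 2%nat ltac:(lia)).
  - apply (Derive_correct (Derive_n f 2)). exact (HD 3%nat ltac:(lia)).
Qed.

Lemma f_continuous x : 0 <= x <= 1 -> continuity_pt f x.
Proof.
  intros Hx. destruct (f_derives x Hx) as (H & _).
  exact (continuity_pt_of_is_derive _ _ _ H).
Qed.

Lemma f_schwarzian x :
  0 <= x <= 1 -> x <> c ->
  Derive_n f 3 x * Derive f x - 3 / 2 * Derive_n f 2 x ^ 2 <= 0.
Proof.
  intros Hx Hxc. destruct Hf as (_ & _ & _ & _ & _ & _ & _ & HS & _).
  destruct (HS x Hx Hxc) as [Hn Hs]. unfold schwarzian in Hs.
  apply (Rmult_lt_compat_r (Derive f x ^ 2)) in Hs; [|nra].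
  replace ((Derive_n f 3 x / Derive f x - 3 / 2 * (Derive_n f 2 x / Derive f x) ^ 2)
           * Derive f x ^ 2)
    with (Derive_n f 3 x * Derive f x - 3 / 2 * Derive_n f 2 x ^ 2) in Hs
    by (field; exact Hn).
  lra.
Qed.

Lemma f_derive_nonzero x : 0 <= x <= 1 -> x <> c -> Derive f x <> 0.
Proof. intros Hx Hxc. apply Hf; assumption. Qed.

Lemma f_schwarz_neg_left x :
  0 < x < c -> schwarz_neg f (Derive f) (Derive_n f 2) (Derive_n f 3) x.
Proof.
  intros Hx. pose proof c_range.
  destruct (f_derives x ltac:(lra)) as (H1 & H2 & H3).
  split; [exact H1|split; [exact H2|split; [exact H3|split]]].
  - assert (0 <= Derive f x).
    { apply (derive_nonneg_of_increasing f x _ (c - x)); [lra| |exact H1].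
      intros y Hy. apply Rlt_le, f_increasing; lra. }
    pose proof (f_derive_nonzero x ltac:(lra) ltac:(lra)). lra.
  - apply f_schwarzian; lra.
Qed.

Lemma f_schwarz_neg_right x :
  c < x < 1 ->
  schwarz_neg (fun t => - f t) (fun t => - Derive f t)
    (fun t => - Derive_n f 2 t) (fun t => - Derive_n f 3 t) x.
Proof.
  intros Hx. pose proof c_range.
  destruct (f_derives x ltac:(lra)) as (H1 & H2 & H3).
  assert (N : is_derive (fun t => - f t) x (- Derive f x)) by exact (is_derive_opp f x _ H1).
  split; [|split; [|split; [|split]]].
  - exact N.
  - exact (is_derive_opp (Derive f) x _ H2).
  - exact (is_derive_opp (Derive_n f 2) x _ H3).
  - assert (0 <= - Derive f x).
    { apply (derive_nonneg_of_increasing (fun t => - f t) x _ (1 - x)); [lra| |exact N].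
      intros y Hy. pose proof (f_decreasing x y ltac:(lra) ltac:(lra) ltac:(lra)). lra. }
    pose proof (f_derive_nonzero x ltac:(lra) ltac:(lra)). lra.
  - pose proof (f_schwarzian x ltac:(lra) ltac:(lra)). lra.
Qed.

(** The ratio [(t - p) (s - q) / ((s - p) (t - q))] does not decrease under [F]. Absolute values
    treat increasing and decreasing branches alike, and clearing denominators avoids division. *)
Definition cross_ratio_expanding (F : R -> R) (p q s t : R) : Prop :=
  Rabs (t - p) * Rabs (s - q) * (Rabs (F s - F p) * Rabs (F t - F q))
  <= Rabs (F t - F p) * Rabs (F s - F q) * (Rabs (s - p) * Rabs (t - q)).

Lemma f_cross_ratio p q s t :
  p < q -> q < s -> s < t ->
  (0 <= p /\ t <= c) \/ (c <= p /\ t <= 1) ->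
  cross_ratio_expanding f p q s t.
Proof.
  intros Hpq Hqs Hst Hside. pose proof c_range. unfold cross_ratio_expanding.
  rewrite (Rabs_right (t - p)), (Rabs_right (s - q)), (Rabs_right (s - p)),
    (Rabs_right (t - q)) by lra.
  destruct Hside as [[H0 Hc]|[Hc H1]].
  - pose proof (f_increasing p s ltac:(lra) ltac:(lra) ltac:(lra)).
    pose proof (f_increasing q t ltac:(lra) ltac:(lra) ltac:(lra)).
    pose proof (f_increasing p t ltac:(lra) ltac:(lra) ltac:(lra)).
    pose proof (f_increasing q s ltac:(lra) ltac:(lra) ltac:(lra)).
    rewrite !Rabs_right by lra.
    apply (cross_ratio_increasing f (Derive f) (Derive_n f 2) (Derive_n f 3)); try assumption.
    + intros x Hx. apply f_continuous. lra.
    + intros x Hx. apply f_schwarz_neg_left. lra.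
  - pose proof (f_decreasing p s ltac:(lra) ltac:(lra) ltac:(lra)).
    pose proof (f_decreasing q t ltac:(lra) ltac:(lra) ltac:(lra)).
    pose proof (f_decreasing p t ltac:(lra) ltac:(lra) ltac:(lra)).
    pose proof (f_decreasing q s ltac:(lra) ltac:(lra) ltac:(lra)).
    rewrite !Rabs_left by lra.
    pose proof (cross_ratio_increasing (fun t => - f t) (fun t => - Derive f t)
      (fun t => - Derive_n f 2 t) (fun t => - Derive_n f 3 t) p q s t Hpq Hqs Hst) as CR.
    cbv beta in CR.
    replace (- (f s - f p)) with (- f s - - f p) by ring.
    replace (- (f t - f p)) with (- f t - - f p) by ring.
    replace (- (f s - f q)) with (- f s - - f q) by ring.
    replace (- (f t - f q)) with (- f t - - f q) by ring.
    apply CR.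
    + intros x Hx. apply (continuity_pt_opp f), f_continuous. lra.
    + intros x Hx. apply f_schwarz_neg_right. lra.
Qed.

Lemma cross_ratio_expanding_rev F p q s t :
  cross_ratio_expanding F t s q p -> cross_ratio_expanding F p q s t.
Proof.
  unfold cross_ratio_expanding. intros H.
  rewrite (Rabs_minus_sym t p), (Rabs_minus_sym s q), (Rabs_minus_sym (F s) (F p)),
    (Rabs_minus_sym (F t) (F q)), (Rabs_minus_sym (F t) (F p)), (Rabs_minus_sym (F s) (F q)),
    (Rabs_minus_sym s p), (Rabs_minus_sym t q). lra.
Qed.

Lemma itr_S n x : itr f (S n) x = f (itr f n x).
Proof. reflexivity. Qed.

Lemma itr_add m n x : itr f (m + n) x = itr f m (itr f n x).
Proof. induction m as [|m IH]; [reflexivity|]. simpl Nat.add. rewrite !itr_S, IH. reflexivity. Qed.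

Lemma itr_S_r n x : itr f (S n) x = itr f n (f x).
Proof. replace (S n) with (n + 1)%nat by lia. apply itr_add. Qed.

Lemma itr_range n x : 0 <= x <= 1 -> 0 <= itr f n x <= 1.
Proof. intros Hx. induction n as [|n IH]; [exact Hx|]. rewrite itr_S. apply f_range, IH. Qed.

Lemma itr_continuous n x : 0 <= x <= 1 -> continuity_pt (itr f n) x.
Proof.
  intros Hx. induction n as [|n IH].
  - apply derivable_continuous_pt, derivable_pt_id.
  - apply (continuity_pt_comp (itr f n) f); [exact IH|]. apply f_continuous, itr_range, Hx.
Qed.

Lemma itr_at_0 n : itr f n 0 = 0.
Proof. induction n as [|n IH]; [reflexivity|]. rewrite itr_S, IH. apply f_0. Qed.

Lemma itr_at_1 n : itr f (S n) 1 = 0.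
Proof. rewrite itr_S_r, f_1. apply itr_at_0. Qed.

Lemma itr_ivt n a b y :
  0 <= a -> a <= b -> b <= 1 ->
  (itr f n a <= y <= itr f n b \/ itr f n b <= y <= itr f n a) ->
  exists x, a <= x <= b /\ itr f n x = y.
Proof.
  intros Ha Hab Hb Hy. apply ivt; [exact Hab| |exact Hy].
  intros x Hx. apply itr_continuous. lra.
Qed.

Lemma itr_at_distance n x y p :
  0 <= x <= 1 -> 0 <= y <= 1 -> 0 <= p <= Rabs (itr f n y - itr f n x) ->
  exists z, Rmin x y <= z <= Rmax x y /\ Rabs (itr f n z - itr f n x) = p.
Proof.
  intros Hx Hy Hp. pose proof (Rmin_glb x y 0). pose proof (Rmax_lub x y 1).
  destruct (Rle_lt_dec (itr f n x) (itr f n y)) as [L|L].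
  - rewrite Rabs_right in Hp by lra.
    destruct (itr_ivt n (Rmin x y) (Rmax x y) (itr f n x + p)) as (z & Hz & E);
      try lra; [apply Rmin_Rmax| |].
    + destruct (Rle_lt_dec x y) as [D|D].
      * rewrite (Rmin_left x y), (Rmax_right x y) by lra. lra.
      * rewrite (Rmin_right x y), (Rmax_left x y) by lra. lra.
    + exists z. split; [exact Hz|]. rewrite E, Rabs_right; lra.
  - rewrite Rabs_left in Hp by lra.
    destruct (itr_ivt n (Rmin x y) (Rmax x y) (itr f n x - p)) as (z & Hz & E);
      try lra; [apply Rmin_Rmax| |].
    + destruct (Rle_lt_dec x y) as [D|D].
      * rewrite (Rmin_left x y), (Rmax_right x y) by lra. lra.
      * rewrite (Rmin_right x y), (Rmax_left x y) by lra. lra.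
    + exists z. split; [exact Hz|]. rewrite E, Rabs_left1; lra.
Qed.

(** Only the open interval is tested, since maximal intervals of monotonicity may end at points that
    an earlier iterate sends to [c]. *)
Definition noncritical (n : nat) (a b : R) : Prop :=
  0 <= a /\ a < b /\ b <= 1 /\
  forall i t, (i < n)%nat -> a < t < b -> itr f i t <> c.

Lemma noncritical_sub n m a b a' b' :
  noncritical n a b -> (m <= n)%nat -> a <= a' -> a' < b' -> b' <= b -> noncritical m a' b'.
Proof.
  intros (H0 & H1 & H2 & H3) Hm Ha Hab Hb. repeat split; try lra.
  intros i t Hi Ht. apply H3; [lia|lra].
Qed.

Lemma noncritical_side n a b :
  noncritical (S n) a b ->
  (forall t, a <= t <= b -> 0 <= itr f n t <= c) \/
  (forall t, a <= t <= b -> c <= itr f n t <= 1).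
Proof.
  intros (H0 & H1 & H2 & H3).
  assert (N : forall x y, a <= x <= b -> a <= y <= b -> itr f n x < c < itr f n y -> False).
  { intros x y Hx Hy Hxy. destruct (Rle_lt_dec x y) as [L|L].
    - destruct (itr_ivt n x y c ltac:(lra) L ltac:(lra) ltac:(lra)) as [t [Ht E]].
      apply (H3 n t); [lia| |exact E].
      destruct (Req_dec t x) as [->|]; [lra|]. destruct (Req_dec t y) as [->|]; lra.
    - destruct (itr_ivt n y x c ltac:(lra) ltac:(lra) ltac:(lra) ltac:(lra)) as [t [Ht E]].
      apply (H3 n t); [lia| |exact E].
      destruct (Req_dec t x) as [->|]; [lra|]. destruct (Req_dec t y) as [->|]; lra. }
  pose proof (H3 n ((a + b) / 2) ltac:(lia) ltac:(lra)) as Hm.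
  destruct (Rlt_le_dec (itr f n ((a + b) / 2)) c) as [L|L]; [left|right];
    intros t Ht; pose proof (itr_range n t ltac:(lra)); split; try lra; apply Rnot_lt_le; intros K.
  - apply (N ((a + b) / 2) t); lra.
  - apply (N t ((a + b) / 2)); lra.
Qed.

Lemma noncritical_monotone n a b :
  noncritical n a b -> strictly_monotone (itr f n) a b.
Proof.
  induction n as [|n IH]; intros Hn.
  - left. intros x y _ H _. exact H.
  - pose proof (noncritical_side n a b Hn) as Hs.
    assert (Hn' : noncritical n a b).
    { pose proof Hn as (? & ? & ? & _). apply (noncritical_sub (S n) n a b); try lra; [exact Hn|lia]. }
    destruct (IH Hn') as [I|D]; destruct Hs as [S|S].
    + left. intros x y Hx Hxy Hy. rewrite !itr_S.
      apply f_increasing; [apply S; lra|apply I; assumption|apply S; lra].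
    + right. intros x y Hx Hxy Hy. rewrite !itr_S.
      apply f_decreasing; [apply S; lra|apply I; assumption|apply S; lra].
    + right. intros x y Hx Hxy Hy. rewrite !itr_S.
      apply f_increasing; [apply S; lra|apply D; assumption|apply S; lra].
    + left. intros x y Hx Hxy Hy. rewrite !itr_S.
      apply f_decreasing; [apply S; lra|apply D; assumption|apply S; lra].
Qed.

(** The inequality for [f ^ n] and that for [f] at the image points multiply; the intermediate
    lengths are positive by strict monotonicity and cancel. *)
Lemma itr_cross_ratio n a b p q s t :
  noncritical n a b -> a <= p -> p < q -> q < s -> s < t -> t <= b ->
  cross_ratio_expanding (itr f n) p q s t.
Proof.
  intros Hn Hp Hpq Hqs Hst Ht.
  induction n as [|n IH]; [unfold cross_ratio_expanding; simpl; lra|].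
  pose proof (noncritical_side n a b Hn) as Hs.
  assert (Hn' : noncritical n a b).
  { pose proof Hn as (? & ? & ? & _). apply (noncritical_sub (S n) n a b); try lra; [exact Hn|lia]. }
  specialize (IH Hn').
  set (F := itr f n) in *.
  assert (CF : cross_ratio_expanding f (F p) (F q) (F s) (F t)).
  { assert (Sd : forall x y, a <= x <= b -> a <= y <= b ->
              (0 <= F x /\ F y <= c) \/ (c <= F x /\ F y <= 1)).
    { intros x y Hx Hy. destruct Hs as [S|S]; [left|right]; split; apply S; assumption. }
    destruct (noncritical_monotone n a b Hn') as [I|D]; [fold F in I|fold F in D].
    - apply f_cross_ratio; try (apply I; lra). apply Sd; lra.
    - apply cross_ratio_expanding_rev, f_cross_ratio; try (apply D; lra). apply Sd; lra. }
  assert (Pos : forall x y, a <= x -> x < y -> y <= b -> 0 < Rabs (F y - F x)).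
  { intros x y Hx Hxy Hy. apply Rabs_pos_lt.
    destruct (noncritical_monotone n a b Hn') as [I|D]; [fold F in I|fold F in D].
    - specialize (I x y Hx Hxy Hy). lra.
    - specialize (D x y Hx Hxy Hy). lra. }
  unfold cross_ratio_expanding in *.
  change (itr f (S n)) with (fun x => f (F x)). cbv beta.
  pose proof (Pos p s ltac:(lra) ltac:(lra) ltac:(lra)) as P1.
  pose proof (Pos q t ltac:(lra) ltac:(lra) ltac:(lra)) as P2.
  assert (PB : 0 < Rabs (F s - F p) * Rabs (F t - F q)) by (apply Rmult_lt_0_compat; assumption).
  apply (Rmult_le_reg_r _ _ _ PB).
  set (B1 := Rabs (F s - F p) * Rabs (F t - F q)) in *.
  set (A1 := Rabs (F t - F p) * Rabs (F s - F q)) in *.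
  set (A := Rabs (t - p) * Rabs (s - q)) in *.
  set (B := Rabs (s - p) * Rabs (t - q)) in *.
  set (A2 := Rabs (f (F t) - f (F p)) * Rabs (f (F s) - f (F q))) in *.
  set (B2 := Rabs (f (F s) - f (F p)) * Rabs (f (F t) - f (F q))) in *.
  assert (0 <= B2) by (apply Rmult_le_pos; apply Rabs_pos).
  assert (0 <= B) by (apply Rmult_le_pos; apply Rabs_pos).
  apply Rle_trans with (A1 * B * B2).
  - replace (A * B2 * B1) with (A * B1 * B2) by ring. apply Rmult_le_compat_r; assumption.
  - replace (A1 * B * B2) with (A1 * B2 * B) by ring.
    replace (A2 * B * B1) with (A2 * B1 * B) by ring. apply Rmult_le_compat_r; assumption.
Qed.

(* The cross-ratio inequality after dropping the factor [(h - w) / (h - s) >= 1]. *)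
Lemma koebe_space n w q s h :
  noncritical n w h -> w < q -> q < s -> s < h ->
  (s - q) * (Rabs (itr f n h - itr f n s) * Rabs (itr f n q - itr f n w))
  <= Rabs (itr f n s - itr f n q) * Rabs (itr f n h - itr f n w) * (q - w).
Proof.
  intros Hn Hwq Hqs Hsh.
  pose proof (itr_cross_ratio n w h w q s h Hn ltac:(lra) Hwq Hqs Hsh ltac:(lra)) as CR.
  unfold cross_ratio_expanding in CR.
  rewrite (Rabs_right (h - w)), (Rabs_right (s - q)), (Rabs_right (s - w)),
    (Rabs_right (h - q)) in CR by lra.
  set (F := itr f n) in *.
  set (L' := Rabs (F h - F s)) in *. set (J' := Rabs (F s - F q)) in *.
  set (R' := Rabs (F q - F w)) in *.
  assert (E : Rabs (F s - F w) = J' + R' /\ Rabs (F h - F q) = L' + J' /\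
              Rabs (F h - F w) = L' + J' + R' /\ 0 < L' /\ 0 < J' /\ 0 < R').
  { unfold L', J', R'.
    destruct (noncritical_monotone n w h Hn) as [I|D]; [fold F in I|fold F in D].
    - pose proof (I w q ltac:(lra) ltac:(lra) ltac:(lra)).
      pose proof (I q s ltac:(lra) ltac:(lra) ltac:(lra)).
      pose proof (I s h ltac:(lra) ltac:(lra) ltac:(lra)).
      rewrite !Rabs_right by lra. lra.
    - pose proof (D w q ltac:(lra) ltac:(lra) ltac:(lra)).
      pose proof (D q s ltac:(lra) ltac:(lra) ltac:(lra)).
      pose proof (D s h ltac:(lra) ltac:(lra) ltac:(lra)).
      rewrite !Rabs_left by lra. lra. }
  destruct E as (E1 & E2 & E3 & P1 & P2 & P3). rewrite E1, E2, E3 in CR. rewrite E3.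
  set (T' := L' + J' + R') in *.
  assert (0 < h - s) by lra. assert (0 < h - w) by lra. assert (0 < q - w) by lra.
  assert (K : (h - w) * (s - q) * (L' * R') <= T' * J' * ((h - s) * (q - w))).
  { replace ((s - w) * (h - q)) with ((h - w) * (s - q) + (h - s) * (q - w)) in CR by ring.
    replace ((J' + R') * (L' + J')) with (T' * J' + L' * R') in CR by (unfold T'; ring).
    lra. }
  apply (Rmult_le_reg_l (h - s)); [assumption|].
  apply Rle_trans with ((h - w) * ((s - q) * (L' * R'))).
  - apply Rmult_le_compat_r; [|lra]. repeat apply Rmult_le_pos; lra.
  - lra.
Qed.

End Unimodal.

Lemma continuity_pt_nbhd (F : R -> R) (x e : R) :
  continuity_pt F x -> 0 < e ->
  exists d, 0 < d /\ forall y, Rabs (y - x) < d -> Rabs (F y - F x) < e.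
Proof.
  intros HC He. destruct (HC e He) as [d [Hd H]]. exists d. split; [exact Hd|].
  intros y Hy. destruct (Req_dec y x) as [->|N].
  - rewrite Rminus_diag, Rabs_R0. exact He.
  - apply (H y). split; [|exact Hy]. split; [exact I|]. intros E. apply N. symmetry. exact E.
Qed.

(** * Renormalization and traps *)

Section Dynamics.
Context (f : R -> R) (c : R) (Hf : S_unimodal f c).

Lemma f_le_max x : 0 <= x <= 1 -> f x <= f c.
Proof.
  intros Hx. pose proof (c_range f c Hf).
  destruct (Rtotal_order x c) as [L|[->|L]]; [|lra|]; apply Rlt_le.
  - apply (f_increasing f c Hf); lra.
  - apply (f_decreasing f c Hf); lra.
Qed.

Lemma critical_value_range : 0 <= f c <= 1.
Proof. apply (f_range f c Hf). pose proof (c_range f c Hf). lra. Qed.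

Lemma itr_le_max n x : 0 <= x <= f c -> 0 <= itr f n x <= f c.
Proof.
  pose proof critical_value_range. intros Hx.
  destruct n as [|n]; [exact Hx|]. split.
  - apply (itr_range f c Hf). lra.
  - rewrite itr_S. apply f_le_max, (itr_range f c Hf). lra.
Qed.

(* [(l, u)] is the symmetric interval [{t | v < f t}] *)
Definition fibre (v l u : R) : Prop :=
  0 <= l /\ l < c /\ c < u /\ u <= 1 /\ f l = v /\ f u = v.

Lemma fibre_exists v : 0 <= v < f c -> exists l u, fibre v l u.
Proof.
  intros Hv. pose proof (c_range f c Hf) as Hc.
  pose proof (f_0 f c Hf). pose proof (f_1 f c Hf).
  destruct (ivt f 0 c v) as [l [Hl El]]; [lra| |lra|].
  { intros x Hx. apply (f_continuous f c Hf). lra. }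
  destruct (ivt f c 1 v) as [u [Hu Eu]]; [lra| |lra|].
  { intros x Hx. apply (f_continuous f c Hf). lra. }
  exists l, u. repeat split; try lra.
  - destruct (Req_dec l c) as [->|]; lra.
  - destruct (Req_dec u c) as [->|]; lra.
Qed.

Lemma fibre_level v l u : fibre v l u -> 0 <= v < f c.
Proof.
  intros (H1 & H2 & H3 & H4 & <- & _). split.
  - apply (f_range f c Hf). lra.
  - apply (f_increasing f c Hf); lra.
Qed.

Lemma fibre_lt v l u t : fibre v l u -> 0 <= t <= 1 -> (v < f t <-> l < t < u).
Proof.
  intros (H1 & H2 & H3 & H4 & H5 & H6) Ht. split.
  - intros Hv. split; apply Rnot_le_lt; intros K.
    + destruct K as [K| ->]; [|lra].
      pose proof (f_increasing f c Hf t l ltac:(lra) K ltac:(lra)). lra.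
    + destruct K as [K|K]; [|subst; lra].
      pose proof (f_decreasing f c Hf u t ltac:(lra) K ltac:(lra)). lra.
  - intros Hlu. destruct (Rle_lt_dec t c) as [L|L].
    + pose proof (f_increasing f c Hf l t ltac:(lra) ltac:(lra) ltac:(lra)). lra.
    + pose proof (f_decreasing f c Hf t u ltac:(lra) ltac:(lra) ltac:(lra)). lra.
Qed.

Lemma fibre_le v l u t : fibre v l u -> 0 <= t <= 1 -> (v <= f t <-> l <= t <= u).
Proof.
  intros HF Ht. pose proof (fibre_lt v l u t HF Ht) as E.
  destruct HF as (H1 & H2 & H3 & H4 & H5 & H6). split.
  - intros [Hv|Hv]; [apply E in Hv; lra|].
    destruct (Rle_lt_dec t c) as [L|L].
    + destruct (Rtotal_order t l) as [K|[->|K]]; [|lra|].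
      * pose proof (f_increasing f c Hf t l ltac:(lra) K ltac:(lra)). lra.
      * lra.
    + destruct (Rtotal_order t u) as [K|[->|K]]; [lra|lra|].
      pose proof (f_decreasing f c Hf u t ltac:(lra) K ltac:(lra)). lra.
  - intros [[K1|K1] [K2|K2]]; [apply Rlt_le, E; lra|subst; lra|subst; lra|subst; lra].
Qed.

(** A monotone iterate meets [c] at most once, so cutting at that point permits one more iterate. *)
Lemma noncritical_subinterval n u v :
  0 <= u -> u < v -> v <= 1 ->
  exists u' v', u <= u' /\ u' < v' /\ v' <= v /\ noncritical f c n u' v'.
Proof.
  intros Hu Huv Hv. induction n as [|n (u' & v' & H1 & H2 & H3 & H4)].
  - exists u, v. repeat split; try lra; intros; lia.
  - destruct (classic (exists t, u' < t < v' /\ itr f n t = c)) as [(t & Ht & E)|N].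
    + exists u', t. split; [lra|]. split; [lra|]. split; [lra|].
      pose proof (noncritical_monotone f c Hf n u' v' H4) as Mn.
      destruct H4 as (K1 & K2 & K3 & K4). repeat split; try lra.
      intros i x Hi Hx. destruct (Nat.eq_dec i n) as [->|Ni]; [|apply K4; [lia|lra]].
      rewrite <- E. destruct Mn as [M|M]; pose proof (M x t ltac:(lra) ltac:(lra) ltac:(lra)); lra.
    + exists u', v'. split; [lra|]. split; [lra|]. split; [lra|].
      destruct H4 as (K1 & K2 & K3 & K4). repeat split; try lra.
      intros i x Hi Hx. destruct (Nat.eq_dec i n) as [->|Ni]; [|apply K4; [lia|lra]].
      intros E. apply N. exists x. split; assumption.
Qed.

Lemma itr_not_locally_constant n u v a :
  0 <= u -> u < v -> v <= 1 -> ~ (forall y, u < y < v -> itr f n y = a).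
Proof.
  intros Hu Huv Hv H.
  destruct (noncritical_subinterval n u v Hu Huv Hv) as (u' & v' & H1 & H2 & H3 & H4).
  pose proof (H ((2 * u' + v') / 3) ltac:(lra)) as E1.
  pose proof (H ((u' + 2 * v') / 3) ltac:(lra)) as E2.
  destruct (noncritical_monotone f c Hf n u' v' H4) as [M|M];
    pose proof (M ((2 * u' + v') / 3) ((u' + 2 * v') / 3) ltac:(lra) ltac:(lra) ltac:(lra)); lra.
Qed.

Lemma itr_near n x e :
  0 <= x <= 1 -> 0 < e ->
  exists d, 0 < d /\ forall y, Rabs (y - x) < d -> Rabs (itr f n y - itr f n x) < e.
Proof.
  intros Hx He. apply continuity_pt_nbhd; [|exact He]. apply (itr_continuous f c Hf), Hx.
Qed.

(* The condition on the superlevel interval [J = {t | a <= f t}] that [f^j] maps [J] into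
   itself while [f J, ..., f^(j-1) J] avoid the interior of [J], read off at [s = f t]. *)
Definition trapping_level (j : nat) (a : R) : Prop :=
  0 <= a < f c /\
  forall s, a <= s <= f c ->
    a <= itr f j s /\ forall m, (1 <= m)%nat -> (m < j)%nat -> itr f m s <= a.

(** A restrictive interval must send its boundary to its boundary, which an arbitrary trap need not
    do. The largest trap for time [j], that is the lowest level, will; continuity shows that the
    infimum is itself trapping. *)
Lemma minimal_trapping_level j a :
  trapping_level j a ->
  exists b, trapping_level j b /\ forall a', trapping_level j a' -> b <= a'.
Proof.
  intros Ha. pose proof critical_value_range as Hc1.
  (* Levels are negated because [completeness] provides suprema. *)
  set (E := fun x => trapping_level j (- x)).
  destruct (completeness E) as [m [Hub Hlub]].
  - exists 0. intros x Hx. destruct Hx as [Hx _]. lra.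
  - exists (- a). unfold E. rewrite Ropp_involutive. exact Ha.
  - set (b := - m). assert (Hlow : forall a', trapping_level j a' -> b <= a').
    { intros a' Ha'. assert (- a' <= m); [|unfold b; lra].
      apply Hub. unfold E. rewrite Ropp_involutive. exact Ha'. }
    assert (Happ : forall x, b < x -> exists a', trapping_level j a' /\ b <= a' < x).
    { intros x Hx. apply NNPP. intros N. assert (m <= - x); [|unfold b in Hx; lra].
      apply Hlub. intros y Hy. apply Rnot_lt_le. intros L. apply N.
      exists (- y). split; [exact Hy|]. split; [apply Hlow, Hy|lra]. }
    assert (Hb0 : 0 <= b).
    { assert (m <= 0); [|unfold b; lra]. apply Hlub. intros y [Hy _]. lra. }
    assert (Hba : b <= a) by (apply Hlow, Ha). pose proof (proj1 Ha) as Ha1.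
    assert (Hin : forall s, b < s <= f c -> b <= itr f j s /\
              forall n, (1 <= n)%nat -> (n < j)%nat -> itr f n s <= b).
    { intros s Hs. split.
      - destruct (Happ s ltac:(lra)) as (a' & Ta & La).
        destruct (proj2 Ta s ltac:(lra)) as [K _]. lra.
      - intros n Hn Hnj. apply Rnot_lt_le. intros L.
        destruct (Happ (Rmin s (itr f n s))) as (a' & Ta & La).
        { apply Rmin_glb_lt; lra. }
        pose proof (Rmin_l s (itr f n s)). pose proof (Rmin_r s (itr f n s)).
        destruct (proj2 Ta s ltac:(lra)) as [_ K]. specialize (K n Hn Hnj). lra. }
    exists b. split; [|exact Hlow]. split; [lra|].
    intros s [[Hs|Hs] Hs']; [apply Hin; lra|subst s].
    assert (Lim : forall n, (forall e, 0 < e -> exists s, b < s <= f c /\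
                     Rabs (itr f n s - itr f n b) < e)).
    { intros n e He. destruct (itr_near n b e ltac:(lra) He) as (d & Hd & K).
      exists (Rmin (b + d / 2) (f c)).
      pose proof (Rmin_l (b + d / 2) (f c)). pose proof (Rmin_r (b + d / 2) (f c)).
      assert (b < Rmin (b + d / 2) (f c)) by (apply Rmin_glb_lt; lra).
      split; [lra|]. apply K. rewrite Rabs_right; lra. }
    split.
    + apply Rnot_lt_le. intros L. destruct (Lim j (b - itr f j b) ltac:(lra)) as (s & Hs1 & K).
      apply Rabs_def2 in K. destruct (Hin s Hs1) as [K' _]. lra.
    + intros n Hn Hnj. apply Rnot_lt_le. intros L.
      destruct (Lim n (itr f n b - b) ltac:(lra)) as (s & Hs1 & K).
      apply Rabs_def2 in K. destruct (Hin s Hs1) as [_ K']. specialize (K' n Hn Hnj). lra.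
Qed.

(** If [b] were mapped strictly above itself, all defining inequalities would be strict with a
    uniform margin, and a slightly lower level would still be trapping. *)
Lemma minimal_trapping_level_fixed j b :
  trapping_level j b -> (forall a', trapping_level j a' -> b <= a') -> itr f j b = b.
Proof.
  intros [Hb Tb] Hmin. pose proof critical_value_range as Hc1.
  apply NNPP. intros N.
  assert (Hjb : b < itr f j b).
  { destruct (Tb b ltac:(lra)) as [K _]. lra. }
  assert (Hb0 : 0 < b).
  { destruct (Req_dec b 0) as [->|]; [|lra]. rewrite (itr_at_0 f c Hf) in N. lra. }
  (* If [itr f m s = b], then [itr f j b] equals [itr f m] of [itr f j s], a point of the trap, so
     it is at most [b]. *)
  assert (Hlt : forall s m, b <= s <= f c -> (1 <= m)%nat -> (m < j)%nat -> itr f m s < b).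
  { intros s m Hs Hm Hmj. destruct (Tb s Hs) as [K1 K2].
    destruct (K2 m Hm Hmj) as [K|K]; [exact K|].
    assert (E : itr f j b = itr f m (itr f j s)).
    { rewrite <- K, <- !itr_add. f_equal. lia. }
    pose proof (itr_le_max j s ltac:(lra)).
    destruct (Tb (itr f j s) ltac:(lra)) as [_ K3]. specialize (K3 m Hm Hmj). lra. }
  (* Compactness of [[b, f c]] gives a common bound [e < b] for the intermediate images, valid also
     slightly below [b]. *)
  assert (Unif : forall M, (M <= j)%nat -> exists e d, e < b /\ 0 < d /\
    forall m s, (1 <= m)%nat -> (m < M)%nat -> b - d < s <= f c -> itr f m s <= e).
  { induction M as [|M IH]; intros HM.
    - exists 0, 1. repeat split; try lra. intros; lia.
    - destruct (IH ltac:(lia)) as (e & d & He & Hd & K).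
      destruct M as [|M].
      { exists 0, 1. repeat split; try lra. intros; lia. }
      destruct (continuity_ab_maj (itr f (S M)) b (f c) ltac:(lra)) as (x & Hx & Hxi).
      { intros y Hy. apply (itr_continuous f c Hf). lra. }
      pose proof (Hlt x (S M) Hxi ltac:(lia) ltac:(lia)) as Hxb.
      set (e' := (itr f (S M) x + b) / 2).
      destruct (itr_near (S M) b (e' - itr f (S M) x) ltac:(lra) ltac:(unfold e'; lra))
        as (d' & Hd' & K').
      exists (Rmax e e'), (Rmin d d').
      pose proof (Rmax_l e e'). pose proof (Rmax_r e e').
      pose proof (Rmin_l d d'). pose proof (Rmin_r d d').
      split; [apply Rmax_lub_lt; unfold e'; lra|]. split; [apply Rmin_glb_lt; lra|].
      intros m s Hm HmM Hs. destruct (Nat.eq_dec m (S M)) as [->|Nm].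
      + destruct (Rle_lt_dec b s) as [L|L].
        * specialize (Hx s ltac:(lra)). unfold e' in *. lra.
        * specialize (K' s). rewrite Rabs_left in K' by lra. specialize (K' ltac:(lra)).
          apply Rabs_def2 in K'. specialize (Hx b ltac:(lra)). lra.
      + specialize (K m s Hm ltac:(lia) ltac:(lra)). lra. }
  destruct (Unif j (Nat.le_refl j)) as (e & d & He & Hd & K).
  destruct (itr_near j b (itr f j b - b) ltac:(lra) ltac:(lra)) as (d' & Hd' & K').
  set (a := Rmax (Rmax e 0) (b - Rmin d d' / 2)).
  assert (0 < Rmin d d') by (apply Rmin_glb_lt; lra).
  pose proof (Rmin_l d d'). pose proof (Rmin_r d d').
  assert (A1 : e <= a) by (eapply Rle_trans; [apply Rmax_l|apply Rmax_l]).
  assert (A2 : 0 <= a) by (eapply Rle_trans; [apply Rmax_r|apply Rmax_l]).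
  assert (A3 : b - Rmin d d' / 2 <= a) by apply Rmax_r.
  assert (A4 : a < b).
  { unfold a. apply Rmax_lub_lt; [apply Rmax_lub_lt; lra|lra]. }
  assert (T : trapping_level j a); [|specialize (Hmin a T); lra].
  split; [lra|]. intros s Hs. split.
  - destruct (Rle_lt_dec b s) as [L|L].
    + destruct (Tb s ltac:(lra)) as [K1 _]. lra.
    + specialize (K' s). rewrite Rabs_left in K' by lra. specialize (K' ltac:(lra)).
      apply Rabs_def2 in K'. lra.
  - intros m Hm Hmj. specialize (K m s Hm Hmj ltac:(lra)). lra.
Qed.

Lemma trapping_level_renormalizable j a :
  (2 <= j)%nat -> trapping_level j a -> renormalizable_with_period f c j.
Proof.
  intros Hj Ha. destruct (minimal_trapping_level j a Ha) as (b & Tb & Hmin).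
  pose proof (minimal_trapping_level_fixed j b Tb Hmin) as Hfix.
  destruct Tb as [Hb Tb].
  destruct (fibre_exists b Hb) as (l & u & HF).
  pose proof HF as (H1 & H2 & H3 & H4 & H5 & H6).
  assert (Hend : forall t, 0 <= t <= 1 -> f t = b -> t = l \/ t = u).
  { intros t Ht E. pose proof (proj1 (fibre_le b l u t HF Ht) ltac:(lra)) as L.
    destruct (Req_dec t l) as [->|]; [left; reflexivity|].
    destruct (Req_dec t u) as [->|]; [right; reflexivity|].
    pose proof (proj2 (fibre_lt b l u t HF Ht) ltac:(lra)). lra. }
  assert (Hboundary : forall t, 0 <= t <= 1 -> f t = b -> itr f j t = l \/ itr f j t = u).
  { intros t Ht E. apply Hend; [apply (itr_range f c Hf), Ht|].
    rewrite <- itr_S, itr_S_r, E. exact Hfix. }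
  exists l, u. unfold restrictive. split; [exact Hj|]. repeat split; try lra.
  - pose proof (proj2 (fibre_le b l u x HF ltac:(lra)) H) as L.
    pose proof (f_le_max x ltac:(lra)). destruct (Tb (f x) ltac:(lra)) as [K _].
    apply (fibre_le b l u (itr f j x) HF); [apply (itr_range f c Hf); lra|].
    rewrite <- itr_S, itr_S_r. exact K.
  - pose proof (proj2 (fibre_le b l u x HF ltac:(lra)) H) as L.
    pose proof (f_le_max x ltac:(lra)). destruct (Tb (f x) ltac:(lra)) as [K _].
    apply (fibre_le b l u (itr f j x) HF); [apply (itr_range f c Hf); lra|].
    rewrite <- itr_S, itr_S_r. exact K.
  - apply Hboundary; lra.
  - apply Hboundary; lra.
  - intros i k Hik Hkj (p & q & Hpq & H).
    (* On an overlap of the images at times [i < k], applying [S (j - k)] more steps gives values at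
       most [b] (from time [i], still intermediate) and at least [b] (from time [k], completing
       [j]). An iterate would thus be constant on an interval. *)
    assert (Hsub : forall y, p < y < q -> 0 <= y <= 1 /\ itr f (S (j - k)) y = b).
    { intros y Hy. destruct (H y Hy) as [(t & Ht & Et) (t' & Ht' & Et')].
      split; [rewrite <- Et; apply (itr_range f c Hf); lra|].
      pose proof (proj2 (fibre_le b l u t HF ltac:(lra)) Ht) as L.
      pose proof (proj2 (fibre_le b l u t' HF ltac:(lra)) Ht') as L'.
      pose proof (f_le_max t ltac:(lra)). pose proof (f_le_max t' ltac:(lra)).
      apply Rle_antisym.
      - rewrite <- Et, <- itr_add. replace (S (j - k) + i)%nat with (S (j - k + i)) by lia.
        rewrite itr_S_r. apply (Tb (f t)); [lra|lia|lia].
      - rewrite <- Et', <- itr_add. replace (S (j - k) + k)%nat with (S j) by lia.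
        rewrite itr_S_r. apply (Tb (f t')); lra. }
    apply (itr_not_locally_constant (S (j - k)) ((2 * p + q) / 3) ((p + 2 * q) / 3) b).
    + apply (Hsub ((2 * p + q) / 3)). lra.
    + lra.
    + apply (Hsub ((p + 2 * q) / 3)). lra.
    + intros y Hy. apply Hsub. lra.
Qed.

Context (Hrec : recurrent f c) (Hper : ~ periodic_pt f c).

Lemma critical_orbit_avoids n : (1 <= n)%nat -> itr f n c <> c.
Proof. intros Hn E. apply Hper. exists n. split; assumption. Qed.

(** The limit would be fixed by [f ^ j]. Its cycle misses [c], as [c] is not periodic, so the
    critical orbit would eventually stay a definite distance from [c], against recurrence. *)
Lemma critical_orbit_not_asymptotic j x :
  (1 <= j)%nat -> 0 <= x <= 1 ->
  ~ Un_cv (fun k => itr f (k * j) (f c)) x.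
Proof.
  intros Hj Hx HL. pose proof critical_value_range as Hc1.
  assert (Hcv : forall i e, 0 < e -> exists K, forall k, (K <= k)%nat ->
              Rabs (itr f (i + k * j) (f c) - itr f i x) < e).
  { intros i e He. destruct (itr_near i x e Hx He) as (d & Hd & K).
    destruct (HL d Hd) as [K0 HK0]. exists K0. intros k Hk.
    rewrite itr_add. apply K, (HK0 k). lia. }
  assert (Fix : itr f j x = x).
  { apply cond_eq. intros e He.
    destruct (Hcv j (e / 2) ltac:(lra)) as [K1 HK1].
    destruct (HL (e / 2) ltac:(lra)) as [K2 HK2].
    specialize (HK1 (K1 + K2)%nat ltac:(lia)).
    specialize (HK2 (S (K1 + K2))%nat ltac:(lia)).
    unfold Rdist in HK2. replace (S (K1 + K2) * j)%nat with (j + (K1 + K2) * j)%nat in HK2 by lia.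
    apply Rabs_def2 in HK1. apply Rabs_def2 in HK2. apply Rabs_def1; lra. }
  assert (Away : forall i, itr f i x <> c).
  { intros i E. apply (critical_orbit_avoids j Hj).
    rewrite <- E at 1. rewrite <- itr_add, Nat.add_comm, itr_add, Fix. exact E. }
  assert (Unif : forall M, exists d K, 0 < d /\ forall i k, (i < M)%nat -> (K <= k)%nat ->
              d <= Rabs (itr f (i + k * j) (f c) - c)).
  { induction M as [|M (d & K & Hd & H)].
    - exists 1, 0%nat. split; [lra|]. intros; lia.
    - set (e := Rabs (itr f M x - c) / 2).
      assert (He : 0 < e).
      { pose proof (Rabs_pos_lt (itr f M x - c)). specialize (Away M). unfold e. lra. }
      destruct (Hcv M e He) as [K' H'].
      exists (Rmin d e), (K + K')%nat. split; [apply Rmin_glb_lt; assumption|].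
      intros i k Hi Hk. destruct (Nat.eq_dec i M) as [->|Ni].
      + eapply Rle_trans; [apply Rmin_r|]. specialize (H' k ltac:(lia)).
        pose proof (Rabs_triang (itr f (M + k * j) (f c) - c)
                      (itr f M x - itr f (M + k * j) (f c))) as Tr.
        replace (itr f (M + k * j) (f c) - c + (itr f M x - itr f (M + k * j) (f c)))
          with (itr f M x - c) in Tr by ring.
        rewrite (Rabs_minus_sym (itr f M x) (itr f (M + k * j) (f c))) in Tr. unfold e in *. lra.
      + eapply Rle_trans; [apply Rmin_l|]. apply H; lia. }
  destruct (Unif j) as (d & K & Hd & H).
  destruct (Hrec d Hd (S (K * j))) as (n & Hn & Hnd).
  destruct n as [|n]; [lia|]. rewrite itr_S_r in Hnd.
  pose proof (Nat.div_mod n j ltac:(lia)) as E.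
  pose proof (Nat.mod_upper_bound n j ltac:(lia)) as B.
  assert (HK : (K <= n / j)%nat) by (apply Nat.div_le_lower_bound; lia).
  specialize (H (n mod j) (n / j)%nat B HK).
  replace (n mod j + n / j * j)%nat with n in H by lia. lra.
Qed.

(** Under an increasing self-map the orbit of [f c] is monotone, hence convergent. *)
Lemma no_increasing_trap j p q :
  (1 <= j)%nat -> 0 <= p -> q <= 1 -> p <= f c <= q ->
  (forall x y, p <= x -> x < y -> y <= q -> itr f j x < itr f j y) ->
  (forall x, p <= x <= q -> p <= itr f j x <= q) -> False.
Proof.
  intros Hj Hp Hq Hc1 Hinc Hmap.
  set (s := fun k => itr f (k * j) (f c)).
  assert (Hs : forall k, p <= s k <= q).
  { induction k as [|k IH]; [exact Hc1|]. unfold s. simpl Nat.mul. rewrite itr_add.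
    apply Hmap, IH. }
  assert (Hstep : forall k, s (S k) = itr f j (s k)).
  { intros k. unfold s. simpl Nat.mul. apply itr_add. }
  assert (Hcases : Un_growing s \/ Un_decreasing s).
  { destruct (Rle_lt_dec (s 0%nat) (s 1%nat)) as [L|L]; [left|right]; intros k;
      induction k as [|k IH]; try lra; rewrite (Hstep (S k)).
    - rewrite (Hstep k) at 1. destruct IH as [IH|IH].
      + apply Rlt_le, Hinc; [apply Hs|exact IH|apply Hs].
      + rewrite <- IH. lra.
    - rewrite (Hstep k) at 2. destruct IH as [IH|IH].
      + apply Rlt_le, Hinc; [apply Hs|exact IH|apply Hs].
      + rewrite IH. lra. }
  assert (Hcv : exists x, Un_cv s x).
  { destruct Hcases as [G|D].
    - destruct (growing_cv s G) as [x Hx]; [|exists x; exact Hx].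
      exists q. intros y [k ->]. apply Hs.
    - destruct (decreasing_cv s D) as [x Hx]; [|exists x; exact Hx].
      exists (- p). intros y [k ->]. unfold opp_seq. specialize (Hs k). lra. }
  destruct Hcv as [x Hx].
  assert (p <= x <= q).
  { split.
    - apply (@Rle_cv_lim (fun _ => p) s p x); [intros; apply Hs| |exact Hx].
      intros e He. exists 0%nat. intros. rewrite Rdist_eq. exact He.
    - apply (@Rle_cv_lim s (fun _ => q) x q); [intros; apply Hs|exact Hx|].
      intros e He. exists 0%nat. intros. rewrite Rdist_eq. exact He. }
  exact (critical_orbit_not_asymptotic j x Hj ltac:(lra) Hx).
Qed.

Lemma no_monotone_trap j p q :
  (1 <= j)%nat -> 0 <= p -> q <= 1 -> p <= f c <= q ->
  strictly_monotone (itr f j) p q ->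
  (forall x, p <= x <= q -> p <= itr f j x <= q) -> False.
Proof.
  intros Hj Hp Hq Hc1 [I|D] Hmap.
  - exact (no_increasing_trap j p q Hj Hp Hq Hc1 I Hmap).
  - apply (no_increasing_trap (j + j) p q); try assumption; [lia| |].
    + intros x y Hx Hxy Hy. rewrite !itr_add. apply D.
      * apply Hmap. lra.
      * apply D; lra.
      * apply Hmap. lra.
    + intros x Hx. rewrite itr_add. apply Hmap, Hmap, Hx.
Qed.

End Dynamics.

(** * First exits of a continuous function from an interval *)

Lemma exit_right (F : R -> R) (l u t : R) :
  (forall x, 0 <= x <= 1 -> continuity_pt F x) ->
  0 <= t <= 1 -> l < F t < u -> ~ (l < F 1 < u) ->
  exists b, t < b /\ b <= 1 /\ (forall s, t <= s < b -> l < F s < u) /\ (F b = l \/ F b = u).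
Proof.
  intros Hc Ht Hin Hout.
  set (E := fun x => t <= x <= 1 /\ forall s, t <= s <= x -> l < F s < u).
  destruct (completeness E) as [b [Hub Hlub]].
  - exists 1. intros x [Hx _]. lra.
  - exists t. split; [lra|]. intros s Hs. replace s with t by lra. exact Hin.
  - assert (Htb : t <= b).
    { apply Hub. split; [lra|]. intros s Hs. replace s with t by lra. exact Hin. }
    assert (Hb1 : b <= 1) by (apply Hlub; intros x [Hx _]; lra).
    assert (Hbelow : forall s, t <= s < b -> l < F s < u).
    { intros s Hs. apply NNPP. intros N. assert (b <= s); [|lra].
      apply Hlub. intros x [Hx Kx]. apply Rnot_lt_le. intros L. apply N, Kx. lra. }
    assert (Hnot : ~ (l < F b < u)).
    { intros Hb. assert (b < 1) by (destruct (Req_dec b 1) as [->|]; [contradiction|lra]).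
      destruct (continuity_pt_nbhd F b (Rmin (F b - l) (u - F b)) (Hc b ltac:(lra)))
        as (d & Hd & K); [apply Rmin_glb_lt; lra|].
      pose proof (Rmin_l (F b - l) (u - F b)). pose proof (Rmin_r (F b - l) (u - F b)).
      assert (Hx : Rmin 1 (b + d / 2) <= b); [|
        assert (b < Rmin 1 (b + d / 2)) by (apply Rmin_glb_lt; lra); lra].
      pose proof (Rmin_l 1 (b + d / 2)). pose proof (Rmin_r 1 (b + d / 2)).
      assert (b < Rmin 1 (b + d / 2)) by (apply Rmin_glb_lt; lra).
      apply Hub. split; [lra|]. intros s Hs. destruct (Rlt_le_dec s b) as [L|L].
      - apply Hbelow. lra.
      - specialize (K s). rewrite Rabs_right in K by lra. specialize (K ltac:(lra)).
        apply Rabs_def2 in K. lra. }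
    assert (Hlt : t < b).
    { destruct (Req_dec t b) as [->|]; [contradiction|lra]. }
    exists b. split; [exact Hlt|]. split; [exact Hb1|]. split; [exact Hbelow|].
    assert (Hcl : l <= F b <= u); [|destruct (Req_dec (F b) l); [left; assumption|];
      destruct (Req_dec (F b) u); [right; assumption|lra]].
    assert (Happ : forall e, 0 < e -> exists s, t <= s < b /\ Rabs (F s - F b) < e).
    { intros e He. destruct (continuity_pt_nbhd F b e (Hc b ltac:(lra)) He) as (d & Hd & K).
      exists (Rmax t (b - d / 2)).
      pose proof (Rmax_l t (b - d / 2)). pose proof (Rmax_r t (b - d / 2)).
      assert (Rmax t (b - d / 2) < b) by (apply Rmax_lub_lt; lra).
      split; [lra|]. apply K. rewrite Rabs_left; lra. }
    split; apply Rnot_lt_le; intros L.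
    + destruct (Happ (l - F b) ltac:(lra)) as (s & Hs & K).
      apply Rabs_def2 in K. specialize (Hbelow s Hs). lra.
    + destruct (Happ (F b - u) ltac:(lra)) as (s & Hs & K).
      apply Rabs_def2 in K. specialize (Hbelow s Hs). lra.
Qed.

Lemma exit_left (F : R -> R) (l u t : R) :
  (forall x, 0 <= x <= 1 -> continuity_pt F x) ->
  0 <= t <= 1 -> l < F t < u -> ~ (l < F 0 < u) ->
  exists a, 0 <= a /\ a < t /\ (forall s, a < s <= t -> l < F s < u) /\ (F a = l \/ F a = u).
Proof.
  intros Hc Ht Hin Hout.
  destruct (exit_right (fun x => F (1 - x)) l u (1 - t)) as (b & H1 & H2 & H3 & H4).
  - intros x Hx. apply (continuity_pt_comp (fun x => 1 - x) F).
    + apply continuity_pt_minus; [apply continuity_pt_const; intros ? ?; reflexivity|].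
      apply derivable_continuous_pt, derivable_pt_id.
    + apply Hc. lra.
  - lra.
  - replace (1 - (1 - t)) with t by ring. exact Hin.
  - replace (1 - 1) with 0 by ring. exact Hout.
  - exists (1 - b). repeat split; try lra.
    + replace s with (1 - (1 - s)) by ring. apply H3. lra.
    + replace s with (1 - (1 - s)) by ring. apply H3. lra.
Qed.

(** * Nice levels and first returns *)

Section Returns.
Context (f : R -> R) (c : R) (Hf : S_unimodal f c).
Context (Hrec : recurrent f c) (Hper : ~ periodic_pt f c).

(* [v = f x] with [x] nice: the orbit of [x] avoids [{t | v < f t}] *)
Definition nice_level (v : R) : Prop :=
  0 <= v < f c /\ forall n, (1 <= n)%nat -> itr f n v <= v.

(* [S n] is the first return time of [c] to [{t | v < f t}] *)
Definition first_return (v : R) (n : nat) : Prop :=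
  v < itr f (S n) (f c) /\
  forall i, (1 <= i)%nat -> (i <= n)%nat -> itr f i (f c) <= v.

Lemma recurrence_level v M :
  0 <= v < f c -> exists n, (M < n)%nat /\ v < itr f n (f c).
Proof.
  intros Hv. destruct (fibre_exists f c Hf v Hv) as (l & u & HF).
  pose proof HF as (H1 & H2 & H3 & H4 & _).
  destruct (Hrec (Rmin (c - l) (u - c)) ltac:(apply Rmin_glb_lt; lra) M) as (n & Hn & K).
  pose proof (Rmin_l (c - l) (u - c)). pose proof (Rmin_r (c - l) (u - c)).
  apply Rabs_def2 in K. exists n. split; [exact Hn|].
  rewrite <- itr_S_r, itr_S. apply (fibre_lt f c Hf v l u _ HF); [|lra].
  apply (itr_range f c Hf). lra.
Qed.

Lemma first_return_exists v : 0 <= v < f c -> exists n, first_return v n.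
Proof.
  intros Hv. destruct (recurrence_level v 0 Hv) as (m & Hm & K).
  destruct m as [|m]; [lia|]. clear Hm. revert K.
  induction m as [m IH] using lt_wf_ind. intros K.
  destruct (classic (exists i, (i < m)%nat /\ v < itr f (S i) (f c))) as [(i & Hi & Ki)|N].
  - exact (IH i Hi Ki).
  - exists m. split; [exact K|]. intros i Hi Him. apply Rnot_lt_le. intros L. apply N.
    exists (pred i). replace (S (pred i)) with i by lia. split; [lia|exact L].
Qed.

Lemma critical_orbit_avoids_nice_level v n : nice_level v -> itr f n (f c) <> v.
Proof.
  intros [Hv Hn] E. destruct (recurrence_level v n Hv) as (m & Hm & K).
  replace m with ((m - n) + n)%nat in K by lia. rewrite itr_add, E in K.
  specialize (Hn (m - n)%nat ltac:(lia)). lra.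
Qed.

(* [(a, b)] is the maximal interval around the critical value on which [f^n] maps onto
   [(l, u) = {t | v < f t}]; the central return domain is [{t | a < f t}]. *)
Definition return_branch (v l u : R) (n : nat) (a b : R) : Prop :=
  v <= a /\ a < f c /\ f c < b /\ noncritical f c n a b /\
  (forall s, a < s < b -> l < itr f n s < u) /\
  ((itr f n a = l /\ itr f n b = u) \/ (itr f n a = u /\ itr f n b = l)) /\
  (forall k s, (1 <= k)%nat -> (k <= n)%nat -> a <= s <= b -> itr f k s <= v).

Lemma return_branch_exists v l u n :
  nice_level v -> fibre f c v l u -> first_return v n ->
  exists a b, return_branch v l u n a b.
Proof.
  intros [Hv Hnv] HF [Hr Hr']. pose proof (critical_value_range f c Hf) as Hc1.
  pose proof HF as (H1 & H2 & H3 & H4 & _).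
  pose proof (itr_range f c Hf) as Hrange.
  assert (Hcont : forall x, 0 <= x <= 1 -> continuity_pt (itr f n) x)
    by (intros x Hx; apply (itr_continuous f c Hf), Hx).
  assert (Hlev : forall s, 0 <= s <= 1 -> v < itr f (S n) s <-> l < itr f n s < u).
  { intros s Hs. rewrite itr_S. apply (fibre_lt f c Hf); [exact HF|]. apply Hrange, Hs. }
  assert (H0 : ~ (l < itr f n 0 < u)) by (rewrite (itr_at_0 f c Hf); lra).
  assert (H1' : ~ (l < itr f n 1 < u)).
  { destruct n as [|m]; [simpl; lra|]. rewrite (itr_at_1 f c Hf). lra. }
  pose proof (proj1 (Hlev (f c) Hc1) Hr) as Hin.
  destruct (exit_left (itr f n) l u (f c) Hcont Hc1 Hin H0) as (a & A1 & A2 & A3 & A4).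
  destruct (exit_right (itr f n) l u (f c) Hcont Hc1 Hin H1') as (b & B1 & B2 & B3 & B4).
  assert (Hbr : forall s, a < s < b -> l < itr f n s < u).
  { intros s Hs. destruct (Rle_lt_dec s (f c)); [apply A3|apply B3]; lra. }
  (* Otherwise [v] itself would enter [(l, u)] under [f ^ n], against niceness. *)
  assert (Hav : v <= a).
  { apply Rnot_lt_le. intros L.
    pose proof (proj2 (Hlev v ltac:(lra)) (Hbr v ltac:(lra))) as K.
    specialize (Hnv (S n) ltac:(lia)). lra. }
  (* The value at [f c] is at most [v], so exceeding [v] elsewhere forces equality with [v] at some
     point. From there the orbit never exceeds [v], yet it must do so at time [S n]. This also
     excludes critical points, since an image equal to [c] is followed by [f c > v]. *)
  assert (Hopen : forall k s, (1 <= k)%nat -> (k <= n)%nat -> a < s < b -> itr f k s <= v).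
  { intros k s Hk Hkn Hs. apply Rnot_lt_le. intros L. specialize (Hr' k Hk Hkn).
    assert (exists s', a < s' < b /\ itr f k s' = v) as (s' & Hs' & E).
    { destruct (Rle_lt_dec s (f c)) as [D|D].
      - destruct (itr_ivt f c Hf k s (f c) v ltac:(lra) D ltac:(lra) ltac:(lra)) as (s' & ? & ?).
        exists s'. split; [lra|assumption].
      - destruct (itr_ivt f c Hf k (f c) s v ltac:(lra) ltac:(lra) ltac:(lra) ltac:(lra))
          as (s' & ? & ?).
        exists s'. split; [lra|assumption]. }
    pose proof (proj2 (Hlev s' ltac:(lra)) (Hbr s' Hs')) as K.
    replace (S n) with ((S n - k) + k)%nat in K by lia. rewrite itr_add, E in K.
    specialize (Hnv (S n - k)%nat ltac:(lia)). lra. }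
  assert (Hclosed : forall k s, (1 <= k)%nat -> (k <= n)%nat -> a <= s <= b -> itr f k s <= v).
  { intros k s Hk Hkn Hs. apply Rnot_lt_le. intros L.
    destruct (itr_near f c Hf k s (itr f k s - v) ltac:(lra) ltac:(lra)) as (d & Hd & K).
    assert (exists s', a < s' < b /\ Rabs (s' - s) < d) as (s' & Hs' & D).
    { destruct (Rle_lt_dec s (f c)) as [D|D].
      - exists (Rmin ((s + b) / 2) (s + d / 2)).
        assert (s < Rmin ((s + b) / 2) (s + d / 2)) by (apply Rmin_glb_lt; lra).
        pose proof (Rmin_l ((s + b) / 2) (s + d / 2)).
        pose proof (Rmin_r ((s + b) / 2) (s + d / 2)).
        split; [lra|]. rewrite Rabs_right; lra.
      - exists (Rmax ((s + a) / 2) (s - d / 2)).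
        assert (Rmax ((s + a) / 2) (s - d / 2) < s) by (apply Rmax_lub_lt; lra).
        pose proof (Rmax_l ((s + a) / 2) (s - d / 2)).
        pose proof (Rmax_r ((s + a) / 2) (s - d / 2)).
        split; [lra|]. rewrite Rabs_left; lra. }
    specialize (K s' D). apply Rabs_def2 in K. specialize (Hopen k s' Hk Hkn Hs'). lra. }
  assert (Hnc : noncritical f c n a b).
  { repeat split; try lra. intros i t Hi Ht E.
    specialize (Hopen (S i) t ltac:(lia) ltac:(lia) Ht). rewrite itr_S, E in Hopen. lra. }
  exists a, b. unfold return_branch. repeat (split; [assumption|]). split; [|exact Hclosed].
  destruct (noncritical_monotone f c Hf n a b Hnc) as [M|M];
    pose proof (M a b ltac:(lra) ltac:(lra) ltac:(lra)); lra.
Qed.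

(** More than niceness of [a]: its orbit misses the larger interval at level [v] as well, so
    boundary points of the central domain never return. *)
Lemma return_branch_level v l u n a b k :
  nice_level v -> fibre f c v l u -> return_branch v l u n a b ->
  (1 <= k)%nat -> itr f k a <= v.
Proof.
  intros [Hv Hnv] HF (Hva & Hac & Hcb & Hnc & Hin & Hend & Hk) H1.
  destruct (le_lt_dec k n) as [L|L]; [apply Hk; [lia|lia|lra]|].
  replace k with ((k - S n) + S n)%nat by lia. rewrite itr_add, itr_S.
  destruct HF as (_ & _ & _ & _ & El & Eu).
  assert (E : f (itr f n a) = v) by (destruct Hend as [[-> _]|[-> _]]; assumption).
  rewrite E. destruct (k - S n)%nat as [|m]; [simpl; lra|]. apply Hnv. lia.
Qed.

Lemma return_branch_nice v l u n a b :
  nice_level v -> fibre f c v l u -> return_branch v l u n a b -> nice_level a.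
Proof.
  intros Hv HF Hb. split.
  - destruct Hb as (H1 & H2 & _). destruct Hv as [Hv _]. lra.
  - intros k Hk. pose proof (return_branch_level v l u n a b k Hv HF Hb Hk).
    destruct Hb as (H1 & _). lra.
Qed.

(** At the highest level with a given return time, a further central return cannot refine the level;
    this drives the dichotomy below. The return inequality stays strict in the limit because the
    critical orbit never meets a nice level. *)
Lemma max_nice_level v n :
  nice_level v -> first_return v n ->
  exists w, v <= w /\ nice_level w /\ first_return w n /\
    forall w', nice_level w' -> first_return w' n -> w' <= w.
Proof.
  intros Hv Hr. pose proof (critical_value_range f c Hf) as Hc1.
  set (E := fun w => nice_level w /\ first_return w n).
  destruct (completeness E) as [w [Hub Hlub]].
  - exists (f c). intros x [[Hx _] _]. lra.
  - exists v. split; assumption.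
  - assert (Hvw : v <= w) by (apply Hub; split; assumption).
    assert (Happ : forall x, x < w -> exists w', E w' /\ x < w' <= w).
    { intros x Hx. apply NNPP. intros N. assert (w <= x); [|lra].
      apply Hlub. intros y Hy. apply Rnot_lt_le. intros L. apply N.
      exists y. split; [exact Hy|]. split; [exact L|apply Hub, Hy]. }
    pose proof (itr_le_max f c Hf (S n) (f c) ltac:(lra)) as Hrmax.
    assert (Hle : w <= itr f (S n) (f c)).
    { apply Hlub. intros x [_ [Hx _]]. lra. }
    (* Equality with the maximum would make [c] periodic; this keeps the supremum [w] below
       [f c]. *)
    assert (Hlt : itr f (S n) (f c) < f c).
    { destruct (Rlt_le_dec (itr f (S n) (f c)) (f c)) as [L|L]; [exact L|exfalso].
      apply (critical_orbit_avoids f c Hper (S n) ltac:(lia)).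
      rewrite <- itr_S_r, itr_S in L.
      pose proof (itr_range f c Hf (S n) c ltac:(pose proof (c_range f c Hf); lra)) as R.
      set (t := itr f (S n) c) in *. pose proof (c_range f c Hf).
      destruct (Rtotal_order t c) as [K|[K|K]]; [|exact K|].
      - pose proof (f_increasing f c Hf t c ltac:(lra) K ltac:(lra)). lra.
      - pose proof (f_decreasing f c Hf c t ltac:(lra) K ltac:(lra)). lra. }
    assert (Hnice : nice_level w).
    { destruct Hv as [Hv _]. split; [lra|]. intros k Hk. apply Rnot_lt_le. intros L.
      destruct (itr_near f c Hf k w (itr f k w - w) ltac:(lra) ltac:(lra)) as (d & Hd & K).
      destruct (Happ (w - d) ltac:(lra)) as (w' & [[Hw' Hn'] _] & B).
      specialize (K w'). rewrite Rabs_left1 in K by lra. specialize (K ltac:(lra)).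
      apply Rabs_def2 in K. specialize (Hn' k Hk). lra. }
    exists w. split; [exact Hvw|]. split; [exact Hnice|]. split.
    + split.
      * pose proof (critical_orbit_avoids_nice_level w (S n) Hnice). lra.
      * intros i Hi Hin. destruct Hr as [_ Hr]. specialize (Hr i Hi Hin). lra.
    + intros w' H1 H2. apply Hub. split; assumption.
Qed.

Lemma full_branch_trapping v l u n b :
  nice_level v -> fibre f c v l u -> return_branch v l u n v b -> trapping_level f c (S n) v.
Proof.
  intros Hv HF (Hva & Hac & Hcb & Hnc & Hin & Hend & Hk).
  pose proof (critical_value_range f c Hf) as Hc1. destruct Hv as [Hv Hnv].
  split; [exact Hv|]. intros s Hs. split.
  - rewrite itr_S. apply (fibre_le f c Hf v l u _ HF); [apply (itr_range f c Hf); lra|].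
    destruct HF as (? & ? & ? & ? & _).
    destruct (Req_dec s v) as [->|]; [destruct Hend as [[-> _]|[-> _]]; lra|].
    specialize (Hin s ltac:(lra)). lra.
  - intros m Hm Hmn. apply Hk; [lia|lia|lra].
Qed.

(** At the maximal [w], a critical return inside the central domain makes [a] another nice level
    with the same return time. Maximality then forces [a = w]: the central domain is the whole
    interval. *)
Lemma noncentral_or_full v n :
  nice_level v -> first_return v n ->
  exists w l u a b, v <= w /\ nice_level w /\ first_return w n /\ fibre f c w l u /\
    return_branch w l u n a b /\ (itr f (S n) (f c) < a \/ a = w).
Proof.
  intros Hv Hr. destruct (max_nice_level v n Hv Hr) as (w & Hvw & Hw & Hrw & Hmax).
  destruct (fibre_exists f c Hf w (proj1 Hw)) as (l & u & HF).
  destruct (return_branch_exists w l u n Hw HF Hrw) as (a & b & Hb).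
  exists w, l, u, a, b. repeat (split; [assumption|]).
  pose proof (return_branch_nice w l u n a b Hw HF Hb) as Ha.
  pose proof (critical_orbit_avoids_nice_level a (S n) Ha) as Hne.
  destruct (Rtotal_order (itr f (S n) (f c)) a) as [L|[L|L]]; [left; exact L|contradiction|right].
  destruct Hb as (Hwa & _). apply Rle_antisym; [|exact Hwa].
  apply Hmax; [exact Ha|]. split; [exact L|].
  intros i Hi Hin. destruct Hrw as [_ Hrw]. specialize (Hrw i Hi Hin). lra.
Qed.

(* When the first return map sends the whole interval into itself, its orientation
   reversing fixed point bounds a nice interval that [c] leaves at time [S n]. *)
Lemma full_branch_deeper v l u n b :
  nice_level v -> fibre f c v l u -> return_branch v l u n v b ->
  exists w, nice_level w /\ v <= w /\ itr f (S n) (f c) <= w.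
Proof.
  intros Hv HF Hb. pose proof (full_branch_trapping v l u n b Hv HF Hb) as [_ HT].
  pose proof (critical_value_range f c Hf) as Hc1.
  destruct Hb as (Hva & Hac & Hcb & Hnc & Hin & Hend & Hk). destruct Hv as [Hv Hnv].
  assert (Hnc' : noncritical f c n v (f c)).
  { apply (noncritical_sub f c n n v b); try lra; [exact Hnc|lia]. }
  (* Without a turning point the return map would be a monotone trap around [f c]. *)
  assert (Hcrit : exists k, v < k < f c /\ itr f n k = c).
  { apply NNPP. intros N.
    assert (Hnc1 : noncritical f c (S n) v (f c)).
    { destruct Hnc' as (K1 & K2 & K3 & K4). repeat split; try lra.
      intros i t Hi Ht. destruct (Nat.eq_dec i n) as [->|]; [|apply K4; [lia|lra]].
      intros E. apply N. exists t. split; assumption. }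
    apply (no_monotone_trap f c Hf Hrec Hper (S n) v (f c)); [lia|lra|lra|lra| |].
    - exact (noncritical_monotone f c Hf _ _ _ Hnc1).
    - intros x Hx. destruct (HT x Hx) as [K _].
      pose proof (itr_le_max f c Hf (S n) x ltac:(lra)). lra. }
  destruct Hcrit as (k & Hkv & Ek).
  assert (Hnck : noncritical f c (S n) k (f c)).
  { pose proof (noncritical_monotone f c Hf n v (f c) Hnc') as M.
    destruct Hnc' as (K1 & K2 & K3 & K4). repeat split; try lra.
    intros i t Hi Ht. destruct (Nat.eq_dec i n) as [->|]; [|apply K4; [lia|lra]].
    rewrite <- Ek.
    destruct M as [M|M]; pose proof (M k t ltac:(lra) ltac:(lra) ltac:(lra)); lra. }
  assert (Ek' : itr f (S n) k = f c) by (rewrite itr_S, Ek; reflexivity).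
  assert (Hdec : forall x y, k <= x -> x < y -> y <= f c -> itr f (S n) y < itr f (S n) x).
  { destruct (noncritical_monotone f c Hf (S n) k (f c) Hnck) as [M|M]; [|exact M].
    specialize (M k (f c) ltac:(lra) ltac:(lra) ltac:(lra)).
    pose proof (itr_le_max f c Hf (S n) (f c) ltac:(lra)). lra. }
  pose proof (Hdec k (f c) ltac:(lra) ltac:(lra) ltac:(lra)) as Hlast.
  destruct (ivt (fun s => itr f (S n) s - s) k (f c) 0) as (w & Hw & Ew); [lra| |lra|].
  { intros x Hx. apply continuity_pt_minus; [apply (itr_continuous f c Hf); lra|].
    apply derivable_continuous_pt, derivable_pt_id. }
  assert (Efix : itr f (S n) w = w) by lra.
  assert (Hwc : w < f c) by (destruct (Req_dec w (f c)) as [->|]; lra).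
  exists w. split; [|split; [lra|]].
  - split; [lra|]. intros m. induction m as [m IH] using lt_wf_ind. intros Hm.
    destruct (le_lt_dec (S n) m) as [L|L].
    + replace m with ((m - S n) + S n)%nat by lia. rewrite itr_add, Efix.
      destruct (m - S n)%nat as [|q] eqn:E; [simpl; lra|]. apply IH; lia.
    + destruct (HT w ltac:(lra)) as [_ K]. specialize (K m Hm L). lra.
  - rewrite <- Efix. apply Rlt_le, Hdec; lra.
Qed.

(** Each step finds a nice level not exceeded by the current critical return, so the next return is
    strictly later: the level [a] in the noncentral case, the reversing fixed point in the full
    case. *)
Lemma deep_nice_level M : exists v n, nice_level v /\ first_return v n /\ (M <= n)%nat.
Proof.
  pose proof (critical_value_range f c Hf) as Hc1.
  induction M as [|M (v & n & Hv & Hr & Hn)].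
  - assert (H0 : nice_level 0).
    { split.
      - pose proof (c_range f c Hf). pose proof (f_0 f c Hf).
        pose proof (f_increasing f c Hf 0 c ltac:(lra) ltac:(lra) ltac:(lra)). lra.
      - intros n _. rewrite (itr_at_0 f c Hf). lra. }
    destruct (first_return_exists 0 (proj1 H0)) as (n & Hn).
    exists 0, n. split; [exact H0|]. split; [exact Hn|lia].
  - destruct (noncentral_or_full v n Hv Hr)
      as (w & l & u & a & b & Hvw & Hw & Hrw & HF & Hb & Hcase).
    assert (Hdeep : exists w', nice_level w' /\ w <= w' /\ itr f (S n) (f c) <= w').
    { destruct Hcase as [L|E].
      - exists a. split; [exact (return_branch_nice w l u n a b Hw HF Hb)|].
        destruct Hb as (? & _). split; lra.
      - subst a. destruct (full_branch_deeper w l u n b Hw HF Hb) as (w' & K1 & K2 & K3).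
        exists w'. repeat split; try assumption; apply K1. }
    destruct Hdeep as (w' & K1 & K2 & K3).
    destruct (first_return_exists w' (proj1 K1)) as (m & Hm).
    exists w', m. split; [exact K1|]. split; [exact Hm|].
    destruct (le_lt_dec (S M) m) as [L|L]; [exact L|exfalso].
    destruct Hm as [Hm _]. destruct Hrw as [_ Hrw].
    destruct (Nat.eq_dec m n) as [->|N]; [lra|].
    specialize (Hrw (S m) ltac:(lia) ltac:(lia)). lra.
Qed.

Lemma small_noncentral_level N v0 :
  (forall p, renormalizable_with_period f c p -> (p <= N)%nat) ->
  0 <= v0 < f c ->
  exists v n l u a b, v0 < v /\ (N < n)%nat /\ nice_level v /\ first_return v n /\
    fibre f c v l u /\ return_branch v l u n a b /\ itr f (S n) (f c) < a.
Proof.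
  intros HN Hv0. destruct (recurrence_level v0 0 Hv0) as (i & Hi & Ki).
  (* Return time beyond [i] puts the level above [v0], since the image at time [i] exceeds [v0];
     beyond [N] it excludes the full case, a renormalization of period [S n]. *)
  destruct (deep_nice_level (S (i + N))) as (v & n & Hv & Hr & Hn).
  destruct (noncentral_or_full v n Hv Hr)
    as (w & l & u & a & b & Hvw & Hw & Hrw & HF & Hb & Hcase).
  exists w, n, l, u, a, b. split.
  { destruct Hr as [_ Hr]. specialize (Hr i ltac:(lia) ltac:(lia)). lra. }
  split; [lia|]. repeat (split; [assumption|]).
  destruct Hcase as [L|E]; [exact L|exfalso]. subst a.
  pose proof (full_branch_trapping w l u n b Hw HF Hb) as T.
  pose proof (HN _ (trapping_level_renormalizable f c Hf (S n) w ltac:(lia) T)). lia.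
Qed.

End Returns.

(** * Geometry near the critical point *)

(* [psi] is [phi] or [- phi] for the [phi] of [nonflat_crit]; of its smoothness only the
   bi-Lipschitz bounds are used. *)
Definition power_law (f : R -> R) (c r m M alpha : R) (psi : R -> R) : Prop :=
  0 < r /\ r <= c /\ r <= 1 - c /\ 0 < m /\ m <= M /\ 1 < alpha /\ psi c = 0 /\
  (forall x y, c - r < x -> x < y -> y < c + r -> m * (y - x) <= psi y - psi x <= M * (y - x)) /\
  (forall x, c - r < x < c + r -> f x = f c - apow (psi x) alpha).

Section Shape.
Context (f : R -> R) (c : R) (Hf : S_unimodal f c).

Lemma power_law_exists : exists r m M alpha psi, power_law f c r m M alpha psi.
Proof.
  pose proof (c_range f c Hf) as Hc.
  destruct Hf as (_ & _ & _ & _ & _ & _ & _ & _ & HN).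
  destruct HN as (eps & alpha & phi & He & Ha & H0 & HC & HD & HE).
  set (k := Derive phi c). pose proof (HD c ltac:(lra)) as Hk. fold k in Hk.
  assert (Hcont : continuity_pt (Derive phi) c).
  { destruct (HC c ltac:(lra)) as [Hn _].
    apply (continuity_pt_of_is_derive _ _ (Derive (Derive phi) c)), Derive_correct.
    exact (Hn 2%nat ltac:(lia)). }
  destruct (continuity_pt_nbhd _ c (Rabs k / 2) Hcont) as (d & Hd & K).
  { pose proof (Rabs_pos_lt k Hk). lra. }
  (* The sign makes [psi] increasing; only its absolute value enters the power law. *)
  set (sg := if Rlt_dec 0 k then 1 else -1).
  assert (Hsg : sg * k = Rabs k /\ Rabs sg = 1).
  { unfold sg. destruct (Rlt_dec 0 k).
    - rewrite (Rabs_right k), Rabs_right by lra. lra.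
    - rewrite (Rabs_left k), Rabs_left by lra. lra. }
  destruct Hsg as [Hsk Hs1].
  set (r := Rmin (Rmin eps d) (Rmin c (1 - c))).
  assert (Hr : 0 < r /\ r <= eps /\ r <= d /\ r <= c /\ r <= 1 - c).
  { unfold r. pose proof (Rmin_l (Rmin eps d) (Rmin c (1 - c))).
    pose proof (Rmin_r (Rmin eps d) (Rmin c (1 - c))).
    pose proof (Rmin_l eps d). pose proof (Rmin_r eps d).
    pose proof (Rmin_l c (1 - c)). pose proof (Rmin_r c (1 - c)).
    split; [repeat apply Rmin_glb_lt; lra|]. lra. }
  destruct Hr as (R0 & R1 & R2 & R3 & R4).
  assert (Hphi : forall x, c - r < x < c + r -> is_derive phi x (Derive phi x)).
  { intros x Hx. apply Derive_correct. destruct (HC x ltac:(lra)) as [Hn _].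
    exact (Hn 1%nat ltac:(lia)). }
  pose proof (Rabs_pos_lt k Hk) as Hkp.
  exists r, (Rabs k / 2), (2 * Rabs k), alpha, (fun x => sg * phi x).
  unfold power_law. repeat (split; [lra|]). split; [rewrite H0; ring|]. split.
  - intros x y Hx Hxy Hy.
    destruct (mean_value phi (Derive phi) x y Hxy) as (z & Hz & E).
    + intros t Ht. apply (continuity_pt_of_is_derive _ _ (Derive phi t)), Hphi. lra.
    + intros t Ht. apply Hphi. lra.
    + specialize (K z ltac:(apply Rabs_def1; lra)). fold k in K.
      replace (sg * phi y - sg * phi x) with (sg * Derive phi z * (y - x))
        by (replace (sg * phi y - sg * phi x) with (sg * (phi y - phi x)) by ring; rewrite E; ring).
      assert (K' : Rabs (sg * Derive phi z - Rabs k) < Rabs k / 2).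
      { rewrite <- Hsk at 1. rewrite <- Rmult_minus_distr_l, Rabs_mult, Hs1, Rmult_1_l. exact K. }
      apply Rabs_def2 in K'. split; apply Rmult_le_compat_r; lra.
  - intros x Hx. rewrite HE by lra. unfold apow. rewrite Rabs_mult, Hs1, Rmult_1_l.
    destruct (Req_EM_T (phi x) 0) as [Z|Z]; destruct (Req_EM_T (sg * phi x) 0) as [Z'|Z'];
      try reflexivity; exfalso.
    + apply Z'. rewrite Z. ring.
    + apply Z. apply Rmult_integral in Z'. destruct Z' as [Z'|Z']; [|exact Z'].
      rewrite Z', Rabs_R0 in Hs1. lra.
Qed.

Context (r m M alpha : R) (psi : R -> R) (HP : power_law f c r m M alpha psi).

Lemma psi_right x : c < x < c + r -> m * (x - c) <= psi x <= M * (x - c) /\ 0 < psi x.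
Proof.
  intros Hx. destruct HP as (H1 & H2 & H3 & H4 & H5 & H6 & H7 & H8 & H9).
  pose proof (H8 c x ltac:(lra) ltac:(lra) ltac:(lra)) as K. rewrite H7 in K.
  split; [lra|]. assert (0 < m * (x - c)) by (apply Rmult_lt_0_compat; lra). lra.
Qed.

Lemma psi_left x : c - r < x < c -> m * (c - x) <= - psi x <= M * (c - x) /\ psi x < 0.
Proof.
  intros Hx. destruct HP as (H1 & H2 & H3 & H4 & H5 & H6 & H7 & H8 & H9).
  pose proof (H8 x c ltac:(lra) ltac:(lra) ltac:(lra)) as K. rewrite H7 in K.
  split; [lra|]. assert (0 < m * (c - x)) by (apply Rmult_lt_0_compat; lra). lra.
Qed.

Lemma drop_power x :
  c - r < x < c + r -> x <> c -> f c - f x = Rpower (Rabs (psi x)) alpha /\ 0 < Rabs (psi x).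
Proof.
  intros Hx Hxc.
  assert (Hn : psi x <> 0).
  { destruct (Rlt_le_dec x c) as [L|L].
    - pose proof (psi_left x ltac:(lra)). lra.
    - pose proof (psi_right x ltac:(lra)). lra. }
  destruct HP as (_ & _ & _ & _ & _ & _ & _ & _ & H9).
  split; [|apply Rabs_pos_lt, Hn]. rewrite (H9 x Hx). unfold apow.
  destruct (Req_EM_T (psi x) 0); [contradiction|ring].
Qed.

Lemma drop_scale x y lam :
  c - r < x < c + r -> x <> c -> c - r < y < c + r -> y <> c -> 0 < lam ->
  (f c - f x <= Rpower lam alpha * (f c - f y) <-> Rabs (psi x) <= lam * Rabs (psi y)).
Proof.
  intros Hx Hxc Hy Hyc Hl.
  destruct (drop_power x Hx Hxc) as [-> Px]. destruct (drop_power y Hy Hyc) as [-> Py].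
  assert (Ha : 1 < alpha) by apply HP.
  rewrite Rpower_mult_distr by assumption.
  assert (0 < lam * Rabs (psi y)) by (apply Rmult_lt_0_compat; assumption).
  split.
  - intros K. apply Rnot_lt_le. intros L.
    pose proof (Rlt_Rpower_l _ _ alpha ltac:(lra) (conj H L)). lra.
  - intros K. apply Rle_Rpower_l; lra.
Qed.

Lemma drop_scale_ge x y lam :
  c - r < x < c + r -> x <> c -> c - r < y < c + r -> y <> c -> 0 < lam ->
  Rpower lam alpha * (f c - f y) <= f c - f x -> lam * Rabs (psi y) <= Rabs (psi x).
Proof.
  intros Hx Hxc Hy Hyc Hl.
  destruct (drop_power x Hx Hxc) as [-> Px]. destruct (drop_power y Hy Hyc) as [-> Py].
  assert (Ha : 1 < alpha) by apply HP.
  rewrite Rpower_mult_distr by assumption.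
  assert (0 < lam * Rabs (psi y)) by (apply Rmult_lt_0_compat; assumption).
  intros K. apply Rnot_lt_le. intros L.
  pose proof (Rlt_Rpower_l _ _ alpha ltac:(lra) (conj Px L)). lra.
Qed.

Lemma root_gt_1 t :
  0 < t ->
  1 < Rpower (1 + t) (/ alpha) /\ Rpower (Rpower (1 + t) (/ alpha)) alpha = 1 + t.
Proof.
  intros Ht. assert (Ha : 1 < alpha) by apply HP. split.
  - rewrite <- (Rpower_O (1 + t)) at 1 by lra. apply Rpower_lt; [lra|].
    apply Rinv_0_lt_compat. lra.
  - rewrite Rpower_mult, Rinv_l, Rpower_1; lra.
Qed.

Definition near (x : R) : Prop := c - r < x < c + r.

(** Equal values of [f] mean equal [|psi|] (scale factor 1), so the bi-Lipschitz bounds compare the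
    two distances to [c] up to the factor [M / m]. *)
Lemma fibre_balanced v l u :
  fibre f c v l u -> near l -> near u ->
  m / (m + M) * (u - l) <= u - c /\ m / (m + M) * (u - l) <= c - l.
Proof.
  unfold near. intros (H1 & H2 & H3 & H4 & H5 & H6) Hl Hu.
  assert (Hm : 0 < m <= M) by (split; apply HP).
  pose proof (proj1 (drop_scale l u 1 Hl ltac:(lra) Hu ltac:(lra) ltac:(lra))) as K1.
  pose proof (proj1 (drop_scale u l 1 Hu ltac:(lra) Hl ltac:(lra) ltac:(lra))) as K2.
  destruct (psi_left l ltac:(lra)) as [Ll Nl]. destruct (psi_right u ltac:(lra)) as [Lu Nu].
  rewrite (Rabs_left (psi l)), (Rabs_right (psi u)) in K1, K2 by lra.
  unfold Rpower in K1, K2. rewrite ln_1, Rmult_0_r, exp_0 in K1, K2.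
  specialize (K1 ltac:(lra)). specialize (K2 ltac:(lra)).
  split; apply (Rmult_le_reg_r (m + M)); try lra.
  - replace (m / (m + M) * (u - l) * (m + M)) with (m * (u - l)) by (field; lra). nra.
  - replace (m / (m + M) * (u - l) * (m + M)) with (m * (u - l)) by (field; lra). nra.
Qed.

(** The choice [M * k = (lam - 1) * m * m0] ensures that moving out by [k * (u - l)] multiplies
    [|psi|] by at most [lam], whose power [alpha] is [1 + eta]. *)
Lemma drop_slightly_outside eta :
  0 < eta -> exists k, 0 < k /\ forall v l u e,
    fibre f c v l u -> near l -> near u -> near e ->
    l - k * (u - l) <= e <= u + k * (u - l) -> f c - f e <= (1 + eta) * (f c - v).
Proof.
  intros He. destruct (root_gt_1 eta He) as [Hlam Elam].
  set (lam := Rpower (1 + eta) (/ alpha)) in *.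
  assert (Hm : 0 < m <= M) by (split; apply HP).
  assert (Hm0 : 0 < m / (m + M)).
  { apply Rmult_lt_0_compat; [lra|]. apply Rinv_0_lt_compat. lra. }
  set (m0 := m / (m + M)) in *.
  exists ((lam - 1) * (m * m0) / M). split.
  { apply Rmult_lt_0_compat; [|apply Rinv_0_lt_compat; lra].
    apply Rmult_lt_0_compat; [lra|]. apply Rmult_lt_0_compat; lra. }
  set (k := (lam - 1) * (m * m0) / M).
  assert (Hk : M * k = (lam - 1) * (m * m0)) by (unfold k; field; lra).
  intros v l u e HF Hl Hu Hn Hle.
  destruct (fibre_balanced v l u HF Hl Hu) as [B1 B2]. fold m0 in B1, B2.
  pose proof (fibre_level f c Hf v l u HF) as Hv.
  pose proof HF as (H1 & H2 & H3 & H4 & H5 & H6). unfold near in *.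
  assert (Hr : r <= c /\ r <= 1 - c) by (split; apply HP).
  destruct (Rlt_le_dec e l) as [L|L]; [|destruct (Rlt_le_dec u e) as [L'|L']].
  - rewrite <- H5, <- Elam. apply drop_scale; try lra.
    destruct (psi_left l ltac:(lra)) as [Ll Nl]. destruct (psi_left e ltac:(lra)) as [Le Ne].
    rewrite !Rabs_left by lra.
    assert (D : psi l - psi e <= M * (l - e)) by (apply HP; lra).
    assert (M * (l - e) <= M * k * (u - l)).
    { rewrite Rmult_assoc. apply Rmult_le_compat_l; lra. }
    assert (m * (m0 * (u - l)) <= - psi l).
    { apply Rle_trans with (m * (c - l)); [apply Rmult_le_compat_l|]; lra. }
    rewrite Hk in H. nra.
  - rewrite <- H6, <- Elam. apply drop_scale; try lra.
    destruct (psi_right u ltac:(lra)) as [Lu Nu]. destruct (psi_right e ltac:(lra)) as [Le Ne].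
    rewrite !Rabs_right by lra.
    assert (D : psi e - psi u <= M * (e - u)) by (apply HP; lra).
    assert (M * (e - u) <= M * k * (u - l)).
    { rewrite Rmult_assoc. apply Rmult_le_compat_l; lra. }
    assert (m * (m0 * (u - l)) <= psi u).
    { apply Rle_trans with (m * (u - c)); [apply Rmult_le_compat_l|]; lra. }
    rewrite Hk in H. nra.
  - pose proof (proj2 (fibre_le f c Hf v l u e HF ltac:(lra)) ltac:(lra)). nra.
Qed.

Lemma thin_annulus eps :
  0 < eps -> exists t, 0 < t /\ forall v l u a l' u',
    fibre f c v l u -> fibre f c a l' u' -> near l -> near u -> v <= a ->
    f c - v <= (1 + t) * (f c - a) -> u - u' <= eps * (u - l) /\ l' - l <= eps * (u - l).
Proof.
  intros He. assert (Hm : 0 < m <= M) by (split; apply HP). assert (Ha : 1 < alpha) by apply HP.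
  set (e := eps * m / M).
  assert (Hep : 0 < e).
  { apply Rmult_lt_0_compat; [nra|]. apply Rinv_0_lt_compat. lra. }
  assert (Ee : e * M = eps * m) by (unfold e; field; lra).
  exists (Rpower (1 + e) alpha - 1). split.
  { pose proof (Rpower_lt (1 + e) 0 alpha ltac:(lra) ltac:(lra)) as K.
    rewrite Rpower_O in K by lra. lra. }
  intros v l u a l' u' HF HF' Hl Hu Hva Hd.
  replace (1 + (Rpower (1 + e) alpha - 1)) with (Rpower (1 + e) alpha) in Hd by ring.
  pose proof HF as (H1 & H2 & H3 & H4 & H5 & H6).
  pose proof HF' as (H1' & H2' & H3' & H4' & H5' & H6'). unfold near in *.
  pose proof (proj1 (fibre_le f c Hf v l u l' HF ltac:(lra)) ltac:(lra)) as Il.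
  pose proof (proj1 (fibre_le f c Hf v l u u' HF ltac:(lra)) ltac:(lra)) as Iu.
  pose proof (proj1 (drop_scale l l' (1 + e) Hl ltac:(lra) ltac:(lra) ltac:(lra) ltac:(lra))) as K1.
  pose proof (proj1 (drop_scale u u' (1 + e) Hu ltac:(lra) ltac:(lra) ltac:(lra) ltac:(lra))) as K2.
  rewrite H5, H5' in K1. rewrite H6, H6' in K2. specialize (K1 Hd). specialize (K2 Hd).
  destruct (psi_left l ltac:(lra)) as [Ll Nl]. destruct (psi_left l' ltac:(lra)) as [Ll' Nl'].
  destruct (psi_right u ltac:(lra)) as [Lu Nu]. destruct (psi_right u' ltac:(lra)) as [Lu' Nu'].
  rewrite !Rabs_left in K1 by lra. rewrite !Rabs_right in K2 by lra.
  split; apply (Rmult_le_reg_l m); try lra.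
  - destruct (Req_dec u u') as [->|N]; [nra|].
    assert (D : m * (u - u') <= psi u - psi u') by (apply HP; lra).
    assert (e * psi u' <= e * (M * (u' - c))) by (apply Rmult_le_compat_l; lra).
    assert (eps * m * (u' - c) <= eps * m * (u - l)) by (apply Rmult_le_compat_l; [nra|lra]). nra.
  - destruct (Req_dec l l') as [->|N]; [nra|].
    assert (D : m * (l' - l) <= psi l' - psi l) by (apply HP; lra).
    assert (e * - psi l' <= e * (M * (c - l'))) by (apply Rmult_le_compat_l; lra).
    assert (eps * m * (c - l') <= eps * m * (u - l)) by (apply Rmult_le_compat_l; [nra|lra]). nra.
Qed.

Lemma thick_annulus t :
  0 < t -> exists d, 0 < d /\ forall v l u a l' u',
    fibre f c v l u -> fibre f c a l' u' -> near l -> near u -> v <= a ->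
    (1 + t) * (f c - a) <= f c - v -> d * (u' - l') <= u - u' /\ d * (u' - l') <= l' - l.
Proof.
  intros Ht. destruct (root_gt_1 t Ht) as [Hlam Elam].
  set (lam := Rpower (1 + t) (/ alpha)) in *.
  assert (Hm : 0 < m <= M) by (split; apply HP).
  assert (Hm0 : 0 < m / (m + M)).
  { apply Rmult_lt_0_compat; [lra|]. apply Rinv_0_lt_compat. lra. }
  set (m0 := m / (m + M)) in *.
  exists ((lam - 1) * (m * m0) / M). split.
  { apply Rmult_lt_0_compat; [|apply Rinv_0_lt_compat; lra].
    apply Rmult_lt_0_compat; [lra|]. apply Rmult_lt_0_compat; lra. }
  set (k := (lam - 1) * (m * m0) / M).
  assert (Hk : M * k = (lam - 1) * (m * m0)) by (unfold k; field; lra).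
  intros v l u a l' u' HF HF' Hl Hu Hva Hd. rewrite <- Elam in Hd.
  pose proof HF as (H1 & H2 & H3 & H4 & H5 & H6).
  pose proof HF' as (H1' & H2' & H3' & H4' & H5' & H6').
  pose proof (proj1 (fibre_le f c Hf v l u l' HF ltac:(lra)) ltac:(lra)) as Il.
  pose proof (proj1 (fibre_le f c Hf v l u u' HF ltac:(lra)) ltac:(lra)) as Iu.
  unfold near in *.
  destruct (fibre_balanced a l' u' HF') as [B1 B2]; [unfold near; lra|unfold near; lra|].
  fold m0 in B1, B2.
  pose proof (drop_scale_ge l l' lam Hl ltac:(lra) ltac:(lra) ltac:(lra) ltac:(lra)) as K1.
  pose proof (drop_scale_ge u u' lam Hu ltac:(lra) ltac:(lra) ltac:(lra) ltac:(lra)) as K2.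
  rewrite H5, H5' in K1. rewrite H6, H6' in K2. specialize (K1 Hd). specialize (K2 Hd).
  destruct (psi_left l ltac:(lra)) as [Ll Nl]. destruct (psi_left l' ltac:(lra)) as [Ll' Nl'].
  destruct (psi_right u ltac:(lra)) as [Lu Nu]. destruct (psi_right u' ltac:(lra)) as [Lu' Nu'].
  rewrite !Rabs_left in K1 by lra. rewrite !Rabs_right in K2 by lra.
  split; apply (Rmult_le_reg_l M); try lra; rewrite <- Rmult_assoc, Hk.
  - assert (D : psi u - psi u' <= M * (u - u')).
    { destruct (Req_dec u u') as [->|N]; [lra|]. apply HP; lra. }
    assert (m * (m0 * (u' - l')) <= psi u').
    { apply Rle_trans with (m * (u' - c)); [apply Rmult_le_compat_l|]; lra. }
    assert ((lam - 1) * (m * (m0 * (u' - l'))) <= (lam - 1) * psi u')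
      by (apply Rmult_le_compat_l; lra). lra.
  - assert (D : psi l' - psi l <= M * (l' - l)).
    { destruct (Req_dec l l') as [->|N]; [lra|]. apply HP; lra. }
    assert (m * (m0 * (u' - l')) <= - psi l').
    { apply Rle_trans with (m * (c - l')); [apply Rmult_le_compat_l|]; lra. }
    assert ((lam - 1) * (m * (m0 * (u' - l'))) <= (lam - 1) * - psi l')
      by (apply Rmult_le_compat_l; lra). lra.
Qed.

End Shape.

(** * A priori space *)

Section Space.
Context (f : R -> R) (c : R) (Hf : S_unimodal f c).

Lemma noncritical_point n x :
  0 <= x <= 1 -> (forall i, (i < n)%nat -> itr f i x <> c) ->
  exists d, 0 < d /\ forall i t, (i < n)%nat -> Rabs (t - x) < d -> itr f i t <> c.
Proof.
  intros Hx. induction n as [|n IH]; intros H.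
  - exists 1. split; [lra|]. intros; lia.
  - destruct IH as (d & Hd & K); [intros i Hi; apply H; lia|].
    pose proof (H n ltac:(lia)) as Hn.
    destruct (itr_near f c Hf n x (Rabs (itr f n x - c)) Hx) as (d' & Hd' & K').
    { apply Rabs_pos_lt. lra. }
    exists (Rmin d d'). pose proof (Rmin_l d d'). pose proof (Rmin_r d d').
    split; [apply Rmin_glb_lt; lra|]. intros i t Hi Ht.
    destruct (Nat.eq_dec i n) as [->|]; [|apply K; [lia|lra]].
    intros E. specialize (K' t ltac:(lra)). rewrite E, Rabs_minus_sym in K'. lra.
Qed.

Lemma extend_right n a b :
  noncritical f c n a b ->
  exists x, b <= x /\ noncritical f c n a x /\
    (x = 1 \/ exists i, (i < n)%nat /\ itr f i x = c).
Proof.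
  intros (H0 & H1 & H2 & H3).
  set (E := fun x => b <= x /\ noncritical f c n a x).
  assert (Eb : E b) by (split; [lra|repeat split; assumption]).
  destruct (completeness E) as [x [Hub Hlub]]; [|exists b; exact Eb|].
  { exists 1. intros x [_ (_ & _ & Hx & _)]. exact Hx. }
  assert (Hbx : b <= x) by (apply Hub, Eb).
  assert (Hx1 : x <= 1) by (apply Hlub; intros y [_ (_ & _ & Hy & _)]; exact Hy).
  assert (Hnc : noncritical f c n a x).
  { repeat split; try lra. intros i t Hi Ht.
    destruct (classic (exists y, E y /\ t < y)) as [(y & (_ & (_ & _ & _ & Hy)) & Hty)|N].
    - apply Hy; [exact Hi|lra].
    - exfalso. assert (x <= t); [|lra]. apply Hlub. intros y Hy. apply Rnot_lt_le.
      intros L. apply N. exists y. split; assumption. }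
  exists x. split; [exact Hbx|]. split; [exact Hnc|].
  destruct (Req_dec x 1) as [|N1]; [left; assumption|right].
  apply NNPP. intros N.
  destruct (noncritical_point n x ltac:(lra)) as (d & Hd & K).
  { intros i Hi Ei. apply N. exists i. split; assumption. }
  set (y := Rmin 1 (x + d / 2)).
  assert (x < y) by (apply Rmin_glb_lt; lra).
  assert (y <= 1) by apply Rmin_l. assert (y <= x + d / 2) by apply Rmin_r.
  assert (y <= x); [|lra]. apply Hub. split; [lra|]. repeat split; try lra.
  intros i t Hi Ht. destruct (Rlt_le_dec t x) as [L|L].
  - apply Hnc; [exact Hi|lra].
  - apply K; [exact Hi|]. rewrite Rabs_right; lra.
Qed.

Lemma extend_left n a b :
  noncritical f c n a b ->
  exists x, x <= a /\ noncritical f c n x b /\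
    (x = 0 \/ exists i, (i < n)%nat /\ itr f i x = c).
Proof.
  intros (H0 & H1 & H2 & H3).
  set (E := fun x => - x <= a /\ noncritical f c n (- x) b).
  assert (Ea : E (- a)).
  { unfold E. rewrite Ropp_involutive. split; [lra|repeat split; assumption]. }
  destruct (completeness E) as [x [Hub Hlub]]; [|exists (- a); exact Ea|].
  { exists 0. intros x [_ (Hx & _)]. lra. }
  assert (Hax : - a <= x) by (apply Hub, Ea).
  assert (Hx0 : x <= 0) by (apply Hlub; intros y [_ (Hy & _)]; lra).
  assert (Hnc : noncritical f c n (- x) b).
  { repeat split; try lra. intros i t Hi Ht.
    destruct (classic (exists y, E y /\ - y < t)) as [(y & (_ & (_ & _ & _ & Hy)) & Hty)|N].
    - apply Hy; [exact Hi|lra].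
    - exfalso. assert (x <= - t); [|lra]. apply Hlub. intros y Hy. apply Rnot_lt_le.
      intros L. apply N. exists y. split; [exact Hy|lra]. }
  exists (- x). split; [lra|]. split; [exact Hnc|].
  destruct (Req_dec (- x) 0) as [|N1]; [left; assumption|right].
  apply NNPP. intros N.
  destruct (noncritical_point n (- x) ltac:(lra)) as (d & Hd & K).
  { intros i Hi Ei. apply N. exists i. split; assumption. }
  set (y := Rmin 0 (x + d / 2)).
  assert (x < y) by (apply Rmin_glb_lt; lra).
  assert (y <= 0) by apply Rmin_l. assert (y <= x + d / 2) by apply Rmin_r.
  assert (y <= x); [|lra]. apply Hub. split; [lra|]. repeat split; try lra.
  intros i t Hi Ht. destruct (Rlt_le_dec (- x) t) as [L|L].
  - apply Hnc; [exact Hi|lra].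
  - apply K; [exact Hi|]. rewrite Rabs_left1; lra.
Qed.

Context (Hrec : recurrent f c) (Hper : ~ periodic_pt f c).
Context (N : nat) (HN : forall p, renormalizable_with_period f c p -> (p <= N)%nat).
Context (v l u : R) (n : nat).
Context (Hv : nice_level f c v) (HF : fibre f c v l u) (Hr : first_return f c v n).
(** These hypotheses hold for small intervals around [c]. [Hfar] makes the bound [N] effective: a
    close image of [c] has time beyond [S N], hence cannot produce a renormalization. *)
Context (Hl : u - l < l) (Hu : u - l < 1 - u).
Context (Hfar : forall i, (1 <= i)%nat -> (i <= S N)%nat ->
           ~ (l - (u - l) <= itr f i c <= u + (u - l))).
Context (k : R) (Hk : 0 < k <= / 4).
Context (Hdrop : forall e, l - k * (u - l) <= e <= u + k * (u - l) ->
           f c - f e <= (1 + / 9) * (f c - v)).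

(* A monotone pull-back of [(l, u)] along the critical orbit: the critical point is mapped
   by [f^(S j)] to a point outside [(l, u)], and between the levels [al] and [z] lies a
   first entry domain, mapped onto [(l, u)] by [f^(S j)].  The level [ze] marks a further
   point whose image lies between [(l, u)] and the image of [c]. *)
Definition obstruction (j : nat) (al z ze : R) : Prop :=
  (j < n)%nat /\ al < z /\ z <= ze /\ ze <= v /\ noncritical f c j al (f c) /\
  ((itr f j al = l /\ itr f j z = u) \/ (itr f j al = u /\ itr f j z = l)) /\
  (forall i t, (i < j)%nat -> al < t < z -> itr f (S i) t <= v).

(** Otherwise [f ^ (S j)] maps [[al, f c]] into itself, and [al] turns out to be a trapping level.
    The resulting renormalization has period at most [N], while [Hfar] keeps such early images of
    [c] away from the interval. *)
Lemma obstruction_not_trapped j al z ze :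
  obstruction j al z ze ->
  l - (u - l) <= itr f j (f c) <= u + (u - l) ->
  itr f (S j) (f c) < al.
Proof.
  intros (Hj & Haz & Hzz & Hzv & Hnc & Hend & Hent) Hclose.
  pose proof (critical_value_range f c Hf) as Hc1. destruct Hv as [Hv0 Hvn].
  pose proof (noncritical_monotone f c Hf j al (f c) Hnc) as HM.
  pose proof Hnc as (Ha0 & Hac & _ & Hnc3).
  apply Rnot_le_lt. intros Htr.
  assert (Hfl : f l = v /\ f u = v) by (split; apply HF).
  assert (Hfal : f (itr f j al) = v) by (destruct Hend as [[-> _]|[-> _]]; apply Hfl).
  assert (Hself : forall s, al <= s <= f c -> al <= itr f (S j) s <= f c).
  { intros s Hs. split; [|apply (itr_le_max f c Hf); lra].
    destruct (fibre_exists f c Hf al ltac:(lra)) as (la & ua & HFa).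
    rewrite itr_S in Htr |- *.
    apply (fibre_le f c Hf al la ua _ HFa); [apply (itr_range f c Hf); lra|].
    apply (fibre_le f c Hf al la ua _ HFa) in Htr; [|apply (itr_range f c Hf); lra].
    assert (K : al <= f (itr f j al)) by lra.
    apply (fibre_le f c Hf al la ua _ HFa) in K; [|apply (itr_range f c Hf); lra].
    destruct (Req_dec s al) as [->|Na]; [lra|]. destruct (Req_dec s (f c)) as [->|Nc]; [lra|].
    destruct HM as [M|M]; pose proof (M al s ltac:(lra) ltac:(lra) ltac:(lra));
      pose proof (M s (f c) ltac:(lra) ltac:(lra) ltac:(lra)); lra. }
  assert (Hlow : forall i s, (i < j)%nat -> al <= s <= f c -> itr f (S i) s <= v).
  { intros i s Hi Hs.
    assert (E2 : itr f (S i) (f c) <= v) by (apply Hr; lia).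
    assert (E1 : itr f (S i) al <= v).
    { apply Rnot_lt_le. intros L.
      destruct (itr_near f c Hf (S i) al (itr f (S i) al - v) ltac:(lra) ltac:(lra))
        as (d & Hd & K).
      pose proof (Rmin_l ((al + z) / 2) (al + d / 2)).
      pose proof (Rmin_r ((al + z) / 2) (al + d / 2)).
      assert (al < Rmin ((al + z) / 2) (al + d / 2)) by (apply Rmin_glb_lt; lra).
      specialize (K (Rmin ((al + z) / 2) (al + d / 2))). rewrite Rabs_right in K by lra.
      specialize (K ltac:(lra)). apply Rabs_def2 in K.
      specialize (Hent i (Rmin ((al + z) / 2) (al + d / 2)) Hi ltac:(lra)). lra. }
    destruct (Req_dec s al) as [->|Na]; [lra|]. destruct (Req_dec s (f c)) as [->|Nc]; [lra|].
    assert (Hnci : noncritical f c (S i) al (f c)).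
    { apply (noncritical_sub f c j _ al (f c)); try lra; [exact Hnc|lia]. }
    destruct (noncritical_monotone f c Hf _ _ _ Hnci) as [M|M];
      pose proof (M al s ltac:(lra) ltac:(lra) ltac:(lra));
      pose proof (M s (f c) ltac:(lra) ltac:(lra) ltac:(lra)); lra. }
  (* Such an image would exceed [v] after [S j] more steps. By commutation this is the intermediate
     image of [itr f (S j) s], which [Hlow] bounds by [v]. *)
  assert (Hgap : forall i s, (i < j)%nat -> al <= s <= f c -> ~ (al < itr f (S i) s < z)).
  { intros i s Hi Hs Hg. set (t := itr f (S i) s) in *.
    assert (Ht : v < itr f (S j) t).
    { rewrite itr_S. apply (fibre_lt f c Hf v l u _ HF); [apply (itr_range f c Hf); lra|].
      destruct HM as [M|M]; pose proof (M al t ltac:(lra) ltac:(lra) ltac:(lra));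
        pose proof (M t z ltac:(lra) ltac:(lra) ltac:(lra)); lra. }
    unfold t in Ht. rewrite <- itr_add, Nat.add_comm, itr_add in Ht.
    pose proof (Hlow i _ Hi (Hself s Hs)). lra. }
  assert (T : trapping_level f c (S j) al).
  { split; [lra|]. intros s Hs. split; [apply Hself, Hs|].
    intros [|i] Hi Hij; [lia|]. assert (Hi' : (i < j)%nat) by lia.
    apply Rnot_lt_le. intros L.
    (* The image is connected and misses the gap, so one value above [al] puts all of them above
       [z]; the intermediate iterate is then a monotone trap. *)
    assert (Hz : forall s', al <= s' <= f c -> z <= itr f (S i) s').
    { intros s' Hs'. apply Rnot_lt_le. intros L'.
      pose proof (Hgap i s Hi' Hs) as G. pose proof (Hgap i s' Hi' Hs') as G'.
      assert (exists t, al <= t <= f c /\ itr f (S i) t = (al + z) / 2) as (t & Ht & Et).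
      { destruct (Rle_lt_dec s s') as [D|D].
        - destruct (itr_ivt f c Hf (S i) s s' ((al + z) / 2)) as (t & Ht & Et); try lra.
          exists t. split; [lra|exact Et].
        - destruct (itr_ivt f c Hf (S i) s' s ((al + z) / 2)) as (t & Ht & Et); try lra.
          exists t. split; [lra|exact Et]. }
      apply (Hgap i t Hi' Ht). lra. }
    apply (no_monotone_trap f c Hf Hrec Hper (S i) al (f c)); try lra; [lia| |].
    - apply (noncritical_monotone f c Hf), (noncritical_sub f c j _ al (f c)); try lra; [exact Hnc|lia].
    - intros x Hx. specialize (Hz x Hx). pose proof (Hlow i x Hi' Hx). lra. }
  rewrite <- itr_S_r in Hclose.
  destruct j as [|j].
  - apply (Hfar 1%nat); [lia|lia|exact Hclose].
  - pose proof (HN _ (trapping_level_renormalizable f c Hf (S (S j)) al ltac:(lia) T)).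
    apply (Hfar (S (S j))); [lia|lia|exact Hclose].
Qed.

(* Pushing a monotone pull-back forward to the first time its endpoint [x] hits [c]. *)
Lemma obstruction_from_cut j i p q w x :
  (j <= n)%nat -> (i < j)%nat -> itr f i x = c ->
  (p < q /\ q <= w /\ w < x /\ noncritical f c j p x) \/
  (x < w /\ w <= q /\ q < p /\ noncritical f c j x p) ->
  ((itr f j p = l /\ itr f j q = u) \/ (itr f j p = u /\ itr f j q = l)) ->
  (forall i' t, (i' < j)%nat -> (p < t < q \/ q < t < p) -> itr f (S i') t <= v) ->
  itr f (S i) w <= v ->
  obstruction (j - S i) (itr f (S i) p) (itr f (S i) q) (itr f (S i) w).
Proof.
  intros Hjn Hij Hx Hord Hend Hent Hw.
  set (H := itr f (S i)) in *.
  assert (EH : forall m t, itr f m (H t) = itr f (m + S i) t)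
    by (intros m t; unfold H; rewrite itr_add; reflexivity).
  assert (Hxc : H x = f c) by (unfold H; rewrite itr_S, Hx; reflexivity).
  assert (Hmax : forall t, 0 <= t <= 1 -> 0 <= H t <= f c).
  { intros t Ht. unfold H. rewrite itr_S. split.
    - apply (f_range f c Hf), (itr_range f c Hf), Ht.
    - apply (f_le_max f c Hf), (itr_range f c Hf), Ht. }
  assert (Hb : 0 <= p <= 1 /\ 0 <= x <= 1).
  { destruct Hord as [(? & ? & ? & ? & ? & ? & _)|(? & ? & ? & ? & ? & ? & _)]; lra. }
  assert (Hto : forall s t, (p <= s /\ s < t /\ t <= x) \/ (x <= t /\ t < s /\ s <= p) ->
                 H s < H t).
  { destruct Hord as [(O1 & O2 & O3 & Hnc)|(O1 & O2 & O3 & Hnc)].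
    - assert (Hnc' : noncritical f c (S i) p x).
      { apply (noncritical_sub f c j _ p x); try lra; [exact Hnc|lia]. }
      destruct (noncritical_monotone f c Hf _ _ _ Hnc') as [M|M].
      + intros s t [?|?]; [|lra]. apply M; lra.
      + specialize (M p x ltac:(lra) ltac:(lra) ltac:(lra)). fold H in M.
        specialize (Hmax p ltac:(lra)). lra.
    - assert (Hnc' : noncritical f c (S i) x p).
      { apply (noncritical_sub f c j _ x p); try lra; [exact Hnc|lia]. }
      destruct (noncritical_monotone f c Hf _ _ _ Hnc') as [M|M].
      + specialize (M x p ltac:(lra) ltac:(lra) ltac:(lra)). fold H in M.
        specialize (Hmax p ltac:(lra)). lra.
      + intros s t [?|?]; [lra|]. apply M; lra. }
  assert (Hiv : forall y t, (p < y <= x \/ x <= y < p) -> H p < t < H y ->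
                  exists s, (p < s < y \/ y < s < p) /\ H s = t).
  { intros y t Hy Ht. destruct Hy as [Hy|Hy].
    - destruct (itr_ivt f c Hf (S i) p y t ltac:(lra) ltac:(lra) ltac:(lra)) as (s & Hs & Es);
        [left; fold H; lra|]. fold H in Es.
      exists s. split; [|exact Es].
      destruct (Req_dec s p) as [->|]; [lra|]. destruct (Req_dec s y) as [->|]; lra.
    - destruct (itr_ivt f c Hf (S i) y p t ltac:(lra) ltac:(lra) ltac:(lra)) as (s & Hs & Es);
        [right; fold H; lra|]. fold H in Es.
      exists s. split; [|exact Es].
      destruct (Req_dec s p) as [->|]; [lra|]. destruct (Req_dec s y) as [->|]; lra. }
  assert (Hpq : H p < H q) by (apply Hto; lra).
  assert (Hpx : H p < H x) by (apply Hto; lra).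
  assert (Hqw : H q <= H w).
  { destruct (Req_dec q w) as [->|]; [lra|]. apply Rlt_le, Hto. lra. }
  pose proof (critical_value_range f c Hf).
  split; [lia|]. split; [exact Hpq|]. split; [exact Hqw|]. split; [exact Hw|].
  split; [|split].
  - split; [apply Hmax; lra|]. split; [lra|]. split; [lra|].
    intros i' t Hi' Ht. rewrite <- Hxc in Ht.
    destruct (Hiv x t ltac:(lra) Ht) as (s & Hs & <-). rewrite EH.
    destruct Hord as [(O1 & O2 & O3 & (_ & _ & _ & Hnc))|(O1 & O2 & O3 & (_ & _ & _ & Hnc))];
      apply Hnc; try lia; lra.
  - rewrite !EH. replace (j - S i + S i)%nat with j by lia. exact Hend.
  - intros i' t Hi' Ht. destruct (Hiv q t ltac:(lra) Ht) as (s & Hs & <-).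
    rewrite EH. change (S i' + S i)%nat with (S (i' + S i)). apply Hent; [lia|exact Hs].
Qed.

Lemma critical_value_lt_1 : f c < 1.
Proof.
  pose proof (critical_value_range f c Hf). destruct (Req_dec (f c) 1) as [E|]; [exfalso|lra].
  destruct Hr as [K _]. rewrite E, (itr_at_1 f c Hf) in K. destruct Hv as [Hv0 _]. lra.
Qed.

(* If the extension of the pull-back beyond [c] stopped close to [(l, u)], the Koebe space
   lemma would make the next extension at least three times shorter, and so on along
   decreasing times. *)
Lemma no_close_obstruction j al z ze :
  obstruction j al z ze ->
  k * (u - l) < Rabs (itr f j (f c) - itr f j z) + Rabs (itr f j (f c) - itr f j ze).
Proof.
  revert al z ze. induction j as [j IH] using lt_wf_ind. intros al z ze HO.
  apply Rnot_le_lt. intros Hclose.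
  pose proof HO as (Hj & Haz & Hzz & Hzv & Hnc & Hend & Hent).
  pose proof (critical_value_range f c Hf) as Hc1. pose proof critical_value_lt_1 as Hlt1.
  pose proof Hv as [Hv0 Hvn]. pose proof HF as (Hl0 & Hlc & Hcu & Hu1 & _).
  set (D := u - l) in *. assert (HD : 0 < D) by (unfold D; lra).
  assert (HkD : 0 < k * D <= D / 4) by (split; [apply Rmult_lt_0_compat; lra|nra]).
  set (F := itr f j) in *.
  pose proof (noncritical_monotone f c Hf j al (f c) Hnc) as HM. fold F in HM.
  pose proof Hnc as (Ha0 & Hac & _ & _).
  assert (Hgeo : Rabs (F (f c) - F al) = D + Rabs (F (f c) - F z) /\
                 0 < Rabs (F (f c) - F ze) /\
                 Rabs (F (f c) - F ze) + Rabs (F ze - F al) = Rabs (F (f c) - F al) /\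
                 D <= Rabs (F ze - F al) /\
                 l - k * D <= F (f c) <= u + k * D).
  { assert (Hord : F z = F ze \/ z < ze) by (destruct Hzz as [ | -> ]; [right|left]; auto).
    destruct HM as [M|M]; pose proof (M al z ltac:(lra) ltac:(lra) ltac:(lra));
      pose proof (M z (f c) ltac:(lra) ltac:(lra) ltac:(lra));
      pose proof (M al ze ltac:(lra) ltac:(lra) ltac:(lra));
      pose proof (M ze (f c) ltac:(lra) ltac:(lra) ltac:(lra)).
    - assert (F z <= F ze) by (destruct Hord; [lra|apply Rlt_le, M; lra]).
      rewrite (Rabs_right (F (f c) - F z)), (Rabs_right (F (f c) - F ze)) in Hclose by lra.
      rewrite !Rabs_right by lra. unfold D in *. lra.
    - assert (F ze <= F z) by (destruct Hord; [lra|apply Rlt_le, M; lra]).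
      rewrite (Rabs_left (F (f c) - F z)), (Rabs_left (F (f c) - F ze)) in Hclose by lra.
      rewrite !Rabs_left by lra. unfold D in *. lra. }
  destruct Hgeo as (G1 & G2 & G3 & G4 & G5).
  set (d := Rabs (F (f c) - F z)) in *. set (sg := Rabs (F (f c) - F ze)) in *.
  assert (0 <= d) by apply Rabs_pos.
  (* By [Hdrop] the return drop is at most [10 / 9] of [f c - v], hence of [f c - ze], and it
     exceeds [f c - al]. *)
  assert (HR : ze - al <= / 9 * (f c - ze)).
  { pose proof (Hdrop (F (f c)) G5) as K.
    pose proof (obstruction_not_trapped j al z ze HO) as K'. rewrite itr_S in K'. fold F in K'.
    specialize (K' ltac:(fold D; lra)). lra. }
  destruct (extend_right j al (f c) Hnc) as (x & Hcx & Hncx & Hcut).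
  assert (Hcx' : f c < x).
  { destruct Hcx as [|<-]; [assumption|exfalso]. destruct Hcut as [E|(i & Hi & E)]; [lra|].
    rewrite <- itr_S_r in E. apply (critical_orbit_avoids f c Hper (S i) ltac:(lia) E). }
  pose proof (noncritical_monotone f c Hf j al x Hncx) as HMx. fold F in HMx.
  pose proof Hncx as (_ & _ & Hx1 & _).
  assert (Hs0 : 0 < Rabs (F x - F (f c))).
  { apply Rabs_pos_lt.
    destruct HMx as [M|M]; specialize (M (f c) x ltac:(lra) ltac:(lra) ltac:(lra)); lra. }
  (* The extension is truncated at image length [D], so the total image is at most [3 * D] and Koebe
     gives [3 * / 9]. Truncation cannot really occur, since [sg / 3] is smaller than [D]. *)
  assert (Hs : Rabs (F x - F (f c)) <= sg / 3).
  { set (y := Rmin (Rabs (F x - F (f c))) D).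
    assert (Hy : 0 < y) by (apply Rmin_glb_lt; assumption).
    assert (Hyx : y <= Rabs (F x - F (f c))) by apply Rmin_l.
    assert (HyD : y <= D) by apply Rmin_r.
    assert (exists h, f c < h <= x /\ Rabs (F h - F (f c)) = y) as (h & Hh & Eh).
    { destruct (itr_at_distance f c Hf j (f c) x y) as (h & Hh & Eh); [lra|lra|fold F; lra|].
      rewrite Rmin_left, Rmax_right in Hh by lra. exists h. split; [|exact Eh].
      destruct (Req_dec h (f c)) as [->|]; [|lra].
      rewrite Rminus_diag, Rabs_R0 in Eh. lra. }
    assert (Hnch : noncritical f c j al h).
    { apply (noncritical_sub f c j j al x); try lra; [exact Hncx|lia]. }
    pose proof (koebe_space f c Hf j al ze (f c) h Hnch ltac:(lra) ltac:(lra) ltac:(lra)) as KS.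
    fold F in KS. fold sg in KS. rewrite Eh in KS.
    assert (HT : Rabs (F h - F al) <= 3 * D).
    { replace (F h - F al) with ((F h - F (f c)) + (F (f c) - F al)) by ring.
      eapply Rle_trans; [apply Rabs_triang|]. rewrite Eh, G1. lra. }
    assert (Hys : y <= sg / 3).
    { assert (0 < f c - ze) by lra.
      assert (P1 : (f c - ze) * (y * D) <= (f c - ze) * (y * Rabs (F ze - F al))).
      { apply Rmult_le_compat_l; [lra|]. apply Rmult_le_compat_l; lra. }
      assert (P2 : sg * Rabs (F h - F al) * (ze - al) <= sg * (3 * D) * (/ 9 * (f c - ze))).
      { apply Rmult_le_compat; [apply Rmult_le_pos; [lra|apply Rabs_pos]|lra| |exact HR].
        apply Rmult_le_compat_l; lra. }
      apply (Rmult_le_reg_r ((f c - ze) * D)); [apply Rmult_lt_0_compat; lra|]. lra. }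
    destruct (Rle_lt_dec (Rabs (F x - F (f c))) D) as [L|L].
    - unfold y in Hys. rewrite Rmin_left in Hys; lra.
    - exfalso. unfold y in Hys. rewrite Rmin_right in Hys; lra. }
  destruct Hcut as [E|(i & Hi & E)].
  - subst x. destruct j as [|m].
    + change (F 1) with 1 in Hs. rewrite Rabs_right in Hs by lra. lra.
    + unfold F at 1 in Hs. rewrite (itr_at_1 f c Hf), Rabs_minus_sym, Rabs_right in Hs by lra. lra.
  - assert (Hw : itr f (S i) (f c) <= v) by (apply Hr; lia).
    (* The marked point of the next obstruction comes from the old critical value [f c], while [z]
       is kept. *)
    pose proof (obstruction_from_cut j i al z (f c) x ltac:(lia) Hi E
      ltac:(left; repeat split; try lra; apply Hncx) Hend
      ltac:(intros i' t Hi' [Ht|Ht]; [apply Hent; assumption|lra]) Hw) as HO'.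
    specialize (IH (j - S i)%nat ltac:(lia) _ _ _ HO').
    assert (Exc : itr f (j - S i) (f c) = F x).
    { rewrite <- E, <- itr_S, <- itr_add. unfold F. f_equal. lia. }
    rewrite Exc, <- !itr_add in IH. replace (j - S i + S i)%nat with j in IH by lia.
    fold F in IH.
    assert (Rabs (F x - F z) <= Rabs (F x - F (f c)) + d).
    { replace (F x - F z) with ((F x - F (f c)) + (F (f c) - F z)) by ring. apply Rabs_triang. }
    lra.
Qed.

Context (a b : R) (Hb : return_branch f c v l u n a b).

(** If the extension ends at a preimage of [c], it yields an obstruction with [z = ze]. Both
    distances then coincide, whence [k / 2]. If it ends at 1, the image is 0 or 1, farther away than
    [u - l]. *)
Lemma space_right :
  exists x, b <= x /\ noncritical f c n a x /\ k / 2 * (u - l) < Rabs (itr f n x - itr f n b).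
Proof.
  destruct Hb as (Hva & Hac & Hcb & Hnc & Hin & Hend & Hle).
  pose proof Hv as [Hv0 Hvn]. pose proof HF as (Hl0 & Hlc & Hcu & Hu1 & _).
  assert (HkD : k * (u - l) <= (u - l) / 4) by nra.
  destruct (extend_right n a b Hnc) as (x & Hbx & Hncx & Hcut).
  exists x. split; [exact Hbx|]. split; [exact Hncx|].
  destruct Hcut as [E|(i & Hi & E)].
  - subst x. destruct n as [|m].
    + simpl. assert (b = l \/ b = u) by (destruct Hend as [[_ H]|[_ H]]; simpl in H; auto).
      rewrite Rabs_right; [|lra]. lra.
    + rewrite (itr_at_1 f c Hf), Rabs_minus_sym, Rminus_0_r, Rabs_right;
        destruct Hend as [[_ ->]|[_ ->]]; lra.
  - assert (Hw : itr f (S i) b <= v) by (apply Hle; [lia|lia|lra]).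
    assert (Hbx' : b < x).
    { destruct Hbx as [|<-]; [assumption|]. rewrite itr_S, E in Hw. lra. }
    pose proof (obstruction_from_cut n i a b b x ltac:(lia) Hi E
      ltac:(left; split; [lra|split; [lra|split; [lra|exact Hncx]]]) Hend
      ltac:(intros i' t Hi' [Ht|Ht]; [apply Hle; [lia|lia|lra]|lra]) Hw) as HO.
    apply no_close_obstruction in HO.
    assert (Exc : itr f (n - S i) (f c) = itr f n x).
    { rewrite <- E, <- itr_S, <- itr_add. f_equal. lia. }
    rewrite Exc, <- !itr_add in HO. replace (n - S i + S i)%nat with n in HO by lia. lra.
Qed.

Lemma space_left :
  exists x, x <= a /\ noncritical f c n x b /\ k / 2 * (u - l) < Rabs (itr f n x - itr f n a).
Proof.
  destruct Hb as (Hva & Hac & Hcb & Hnc & Hin & Hend & Hle).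
  pose proof Hv as [Hv0 Hvn]. pose proof HF as (Hl0 & Hlc & Hcu & Hu1 & _).
  assert (HkD : k * (u - l) <= (u - l) / 4) by nra.
  destruct (extend_left n a b Hnc) as (x & Hxa & Hncx & Hcut).
  exists x. split; [exact Hxa|]. split; [exact Hncx|].
  destruct Hcut as [E|(i & Hi & E)].
  - subst x. rewrite (itr_at_0 f c Hf), Rabs_minus_sym, Rminus_0_r, Rabs_right;
      destruct Hend as [[-> _]|[-> _]]; lra.
  - assert (Hw : itr f (S i) a <= v) by (apply Hle; [lia|lia|lra]).
    assert (Hxa' : x < a).
    { destruct Hxa as [ | -> ]; [assumption|]. rewrite itr_S, E in Hw. lra. }
    pose proof (obstruction_from_cut n i b a a x ltac:(lia) Hi E
      ltac:(right; split; [lra|split; [lra|split; [lra|exact Hncx]]])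
      ltac:(destruct Hend as [[-> ->]|[-> ->]]; auto)
      ltac:(intros i' t Hi' [Ht|Ht]; [lra|apply Hle; [lia|lia|lra]]) Hw) as HO.
    apply no_close_obstruction in HO.
    assert (Exc : itr f (n - S i) (f c) = itr f n x).
    { rewrite <- E, <- itr_S, <- itr_add. f_equal. lia. }
    rewrite Exc, <- !itr_add in HO. replace (n - S i + S i)%nat with n in HO by lia. lra.
Qed.

End Space.

(** * Transfer ranges *)

Section TransferRanges.
Context (f : R -> R) (c : R) (Hf : S_unimodal f c).

Lemma is_tau_fibre v l u t : fibre f c v l u -> (is_tau f c u t <-> t = l).
Proof.
  intros HF. pose proof HF as (H1 & H2 & H3 & H4 & H5 & H6). split.
  - intros (Ht & E & Hne).
    pose proof (proj1 (fibre_le f c Hf v l u t HF Ht) ltac:(lra)) as L.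
    destruct (Req_dec t l) as [|Nl]; [assumption|exfalso].
    destruct Hne as [Nu|[Eu _]]; [|lra].
    pose proof (proj2 (fibre_lt f c Hf v l u t HF Ht) ltac:(lra)). lra.
  - intros ->. split; [lra|]. split; [lra|]. left. lra.
Qed.

Lemma V_fibre v l u y : fibre f c v l u -> (V_ f c u y <-> l < y < u).
Proof.
  intros HF. pose proof HF as (H1 & H2 & H3 & H4 & _). split.
  - intros (t & Ht & Hy). apply (is_tau_fibre v l u t HF) in Ht. subst t.
    rewrite Rmin_right, Rmax_left in Hy by lra. exact Hy.
  - intros Hy. exists l. split; [apply (is_tau_fibre v l u l HF); reflexivity|].
    rewrite Rmin_right, Rmax_left by lra. exact Hy.
Qed.

Lemma nice_fibre v l u : nice_level f c v -> fibre f c v l u -> nice f c u.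
Proof.
  intros [Hv Hn] HF. pose proof HF as (H1 & H2 & H3 & H4 & H5 & H6).
  split; [lra|]. split; [lra|]. intros [|n] HV; apply (V_fibre v l u _ HF) in HV.
  - simpl in HV. lra.
  - apply (fibre_lt f c Hf v l u _ HF) in HV; [|apply (itr_range f c Hf); lra].
    rewrite <- itr_S, itr_S_r, H6 in HV. specialize (Hn (S n) ltac:(lia)). lra.
Qed.

Lemma U_fibre v l u n a b l' u' y :
  nice_level f c v -> fibre f c v l u -> return_branch f c v l u n a b -> fibre f c a l' u' ->
  (U_ f c u y <-> l' < y < u').
Proof.
  intros Hv HF Hb HFa. pose proof HF as (H1 & H2 & H3 & H4 & _).
  pose proof HFa as (H1' & H2' & H3' & H4' & H5' & H6').
  assert (Hno : forall t, 0 <= t <= 1 -> f t = a -> ~ return_dom f c u t).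
  { intros t Ht E (_ & [|j] & Hj & HV); [lia|]. apply (V_fibre v l u _ HF) in HV.
    apply (fibre_lt f c Hf v l u _ HF) in HV; [|apply (itr_range f c Hf), Ht].
    rewrite <- itr_S, itr_S_r, E in HV.
    pose proof (return_branch_level f c v l u n a b (S j) Hv HF Hb ltac:(lia)). lra. }
  split.
  - intros HU. apply NNPP. intros Hy.
    destruct (Rle_lt_dec y l') as [L|L]; [apply (Hno l')|apply (Hno u')]; try lra; apply HU.
    + rewrite Rmin_right, Rmax_left by lra. lra.
    + rewrite Rmin_left, Rmax_right by lra. lra.
  - intros Hy z Hz.
    assert (Hz' : l' < z < u').
    { destruct (Rle_lt_dec c y) as [L|L].
      - rewrite Rmin_left, Rmax_right in Hz by lra. lra.
      - rewrite Rmin_right, Rmax_left in Hz by lra. lra. }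
    pose proof (proj2 (fibre_lt f c Hf a l' u' z HFa ltac:(lra)) Hz') as Hfz.
    pose proof (f_le_max f c Hf z ltac:(lra)).
    destruct Hb as (Hva & Hac & Hcb & _ & Hin & _).
    split.
    + apply (V_fibre v l u z HF), (fibre_lt f c Hf v l u z HF); lra.
    + exists (S n). split; [lia|]. apply (V_fibre v l u _ HF).
      rewrite itr_S_r. apply Hin. lra.
Qed.

Lemma small_levels e :
  0 < e -> exists v0, 0 <= v0 < f c /\ forall t, 0 <= t <= 1 -> v0 < f t -> c - e < t < c + e.
Proof.
  intros He. pose proof (c_range f c Hf) as Hc.
  set (d := Rmin e (Rmin c (1 - c))).
  assert (Hd : 0 < d) by (repeat apply Rmin_glb_lt; lra).
  pose proof (Rmin_l e (Rmin c (1 - c))). pose proof (Rmin_r e (Rmin c (1 - c))).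
  pose proof (Rmin_l c (1 - c)). pose proof (Rmin_r c (1 - c)). fold d in H, H0.
  exists (Rmax (f (c - d)) (f (c + d))).
  pose proof (Rmax_l (f (c - d)) (f (c + d))). pose proof (Rmax_r (f (c - d)) (f (c + d))).
  split.
  - pose proof (f_range f c Hf (c - d) ltac:(lra)). split; [lra|]. apply Rmax_lub_lt.
    + apply (f_increasing f c Hf); lra.
    + apply (f_decreasing f c Hf); lra.
  - intros t Ht Hv. split; apply Rnot_le_lt; intros K.
    + assert (f t <= f (c - d)); [|lra].
      destruct (Req_dec t (c - d)) as [->|]; [lra|].
      apply Rlt_le, (f_increasing f c Hf); lra.
    + assert (f t <= f (c + d)); [|lra].
      destruct (Req_dec t (c + d)) as [->|]; [lra|].
      apply Rlt_le, (f_decreasing f c Hf); lra.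
Qed.

Context (Hrec : recurrent f c) (Hper : ~ periodic_pt f c).

Lemma critical_orbit_far M :
  exists e, 0 < e /\ forall i, (1 <= i)%nat -> (i <= M)%nat -> e <= Rabs (itr f i c - c).
Proof.
  induction M as [|M (e & He & H)].
  - exists 1. split; [lra|]. intros; lia.
  - pose proof (critical_orbit_avoids f c Hper (S M) ltac:(lia)) as Ha.
    exists (Rmin e (Rabs (itr f (S M) c - c))). split.
    + apply Rmin_glb_lt; [exact He|]. apply Rabs_pos_lt. lra.
    + intros i Hi HM. destruct (Nat.eq_dec i (S M)) as [->|N].
      * apply Rmin_r.
      * eapply Rle_trans; [apply Rmin_l|]. apply H; lia.
Qed.

Context (v l u : R) (n : nat) (a b : R).
Context (Hv : nice_level f c v) (HF : fibre f c v l u) (Hr : first_return f c v n).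
Context (Hb : return_branch f c v l u n a b).
Context (k m0 : R) (Hk : 0 < k <= 1) (Hm0 : 0 < m0).
Context (Hbal : m0 * (u - l) <= u - c /\ m0 * (u - l) <= c - l).

(* The critical value of the return map lies close to the endpoint of [(l, u)] hit by the
   boundary of the central domain: then a much larger interval is mapped into half of itself. *)
Lemma low_return_absurd x :
  x <= a -> noncritical f c n x b -> k * (u - l) < Rabs (itr f n x - itr f n a) ->
  (forall e, l - k * (u - l) <= e <= u + k * (u - l) -> f c - f e <= (1 + / 9) * (f c - v)) ->
  f c - v < 2 * (f c - a) ->
  (itr f n a = u /\ c < itr f n (f c)) \/ (itr f n a = l /\ itr f n (f c) < c) ->
  Rabs (itr f n (f c) - itr f n a) <= m0 * k / 8 * (u - l) ->
  False.
Proof.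
  intros Hxa Hnc Hx Hdrop Hthin Hside Hclose.
  destruct Hb as (Hva & Hac & Hcb & _ & Hin & Hend & _).
  pose proof HF as (H1 & H2 & H3 & H4 & _).
  pose proof (critical_value_range f c Hf) as Hc1.
  set (F := itr f n) in *. set (D := u - l) in *. assert (HD : 0 < D) by (unfold D; lra).
  assert (HkD : 0 < k * D <= D) by (split; nra).
  pose proof Hnc as (Hx0 & Hxb & Hb1 & _).
  destruct (itr_at_distance f c Hf n a x (k * D)) as (w & Hw & Ew);
    [lra|lra|fold F; lra|]. fold F in Ew.
  rewrite Rmin_right, Rmax_left in Hw by lra.
  assert (Hwa : w < a).
  { destruct (Req_dec w a) as [->|]; [|lra]. rewrite Rminus_diag, Rabs_R0 in Ew. lra. }
  assert (Hncw : noncritical f c n w b).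
  { apply (noncritical_sub f c n n x b); try lra; [exact Hnc|lia]. }
  pose proof (noncritical_monotone f c Hf n w b Hncw) as HM. fold F in HM.
  pose proof (koebe_space f c Hf n w a (f c) b Hncw Hwa Hac Hcb) as KS. fold F in KS.
  pose proof (Hin (f c) ltac:(lra)) as Hinc.
  assert (Hb2 : Rabs (F b - F w) = D + k * D).
  { rewrite (Rabs_minus_sym (F a)) in KS.
    destruct HM as [M|M]; pose proof (M w a ltac:(lra) ltac:(lra) ltac:(lra));
      pose proof (M a b ltac:(lra) ltac:(lra) ltac:(lra)).
    - rewrite Rabs_left in Ew by lra. rewrite Rabs_right by lra. unfold D in *. lra.
    - rewrite Rabs_right in Ew by lra. rewrite Rabs_left by lra. unfold D in *. lra. }
  assert (Hb3 : m0 * D <= Rabs (F b - F (f c))).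
  { destruct HM as [M|M]; pose proof (M a b ltac:(lra) ltac:(lra) ltac:(lra)).
    - rewrite Rabs_right by (apply Rle_ge, Rlt_le; lra). lra.
    - rewrite Rabs_left by lra. lra. }
  rewrite (Rabs_minus_sym (F a)), Ew, Hb2 in KS.
  (* Koebe on [w < a < f c < b]; the total image is at most [2 * D], so the [8] in the closeness
     bound leaves a factor [4]. *)
  assert (Hlong : 4 * (f c - a) <= a - w).
  { assert (P1 : (f c - a) * (m0 * D * (k * D)) <= (f c - a) * (Rabs (F b - F (f c)) * (k * D))).
    { apply Rmult_le_compat_l; [lra|]. apply Rmult_le_compat_r; lra. }
    assert (P2 : Rabs (F (f c) - F a) * (D + k * D) * (a - w)
                 <= m0 * k / 8 * D * (2 * D) * (a - w)).
    { apply Rmult_le_compat_r; [lra|].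
      apply Rmult_le_compat; [apply Rabs_pos|lra|exact Hclose|lra]. }
    assert (0 < m0 * k * D * D) by (repeat apply Rmult_lt_0_compat; lra).
    apply (Rmult_le_reg_r (m0 * k * D * D)); [assumption|]. lra. }
  (* The drop at [F w] is at most [10 / 9 * (f c - v) < 20 / 9 * (f c - a)], while
     [f c - w >= 5 * (f c - a)]. *)
  assert (HFw : l - k * D <= F w <= u + k * D /\ w <= f (F w)).
  { assert (l - k * D <= F w <= u + k * D).
    { destruct HM as [M|M]; pose proof (M w a ltac:(lra) ltac:(lra) ltac:(lra)).
      - rewrite Rabs_left in Ew by lra. lra.
      - rewrite Rabs_right in Ew by lra. lra. }
    split; [assumption|]. specialize (Hdrop (F w) H). lra. }
  assert (Hc2 : w <= f (F (f c))).
  { pose proof (proj2 (fibre_lt f c Hf v l u _ HF (itr_range f c Hf n (f c) Hc1)) Hinc).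
    fold F in H. lra. }
  assert (Hw0 : 0 <= w) by lra.
  destruct (fibre_exists f c Hf w ltac:(lra)) as (lw & uw & HFw').
  assert (HR : forall s, w <= s <= f c -> 0 <= F s <= 1).
  { intros s Hs. apply (itr_range f c Hf). lra. }
  pose proof (proj1 (fibre_le f c Hf w lw uw _ HFw' (HR w ltac:(lra))) (proj2 HFw)) as Q1.
  pose proof (proj1 (fibre_le f c Hf w lw uw _ HFw' (HR (f c) ltac:(lra))) Hc2) as Q2.
  assert (Hmid : forall s, w <= s <= f c -> F s <> c /\ lw <= F s <= uw).
  { intros s Hs.
    assert (E : F s = F w \/ w < s) by (destruct (Req_dec s w) as [->|]; [left|right]; lra).
    assert (E' : F s = F (f c) \/ s < f c) by (destruct (Req_dec s (f c)) as [->|]; [left|right]; lra).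
    destruct HM as [M|M]; pose proof (M w a ltac:(lra) ltac:(lra) ltac:(lra));
      pose proof (M a (f c) ltac:(lra) ltac:(lra) ltac:(lra)).
    - assert (F w <= F s) by (destruct E; [lra|apply Rlt_le, M; lra]).
      assert (F s <= F (f c)) by (destruct E'; [lra|apply Rlt_le, M; lra]).
      split; [|lra]. destruct Hside as [[Es ?]|[Es ?]]; [rewrite Es in *; lra|lra].
    - assert (F s <= F w) by (destruct E; [lra|apply Rlt_le, M; lra]).
      assert (F (f c) <= F s) by (destruct E'; [lra|apply Rlt_le, M; lra]).
      split; [|lra]. destruct Hside as [[Es ?]|[Es ?]]; [lra|rewrite Es in *; lra]. }
  apply (no_monotone_trap f c Hf Hrec Hper (S n) w (f c)); try lra; [lia| |].
  - apply (noncritical_monotone f c Hf).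
    destruct Hncw as (W1 & W2 & W3 & W4). repeat split; try lra.
    intros i t Hi Ht. destruct (Nat.eq_dec i n) as [->|]; [|apply W4; [lia|lra]].
    apply Hmid. lra.
  - intros s Hs. rewrite itr_S. split.
    + apply (fibre_le f c Hf w lw uw _ HFw'); [apply HR, Hs|apply Hmid, Hs].
    + apply (f_le_max f c Hf), HR, Hs.
Qed.

(* The critical value of the return map lies close to the other endpoint of [(l, u)]: the
   points whose image lies beyond the central domain fill almost all of that domain, which
   contradicts the Koebe space beyond the critical value. *)
Lemma high_return_absurd x q :
  b <= x -> noncritical f c n a x -> k * (u - l) < Rabs (itr f n x - itr f n b) ->
  a < q < f c -> q - a < f c - q ->
  m0 * (u - l) <= Rabs (itr f n q - itr f n a) ->
  Rabs (itr f n (f c) - itr f n q) <= m0 * k / 8 * (u - l) ->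
  False.
Proof.
  intros Hbx Hnc Hx Hq Hthin Hfar Hclose.
  destruct Hb as (Hva & Hac & Hcb & _ & Hin & Hend & _).
  pose proof HF as (H1 & H2 & H3 & H4 & _).
  pose proof (critical_value_range f c Hf) as Hc1.
  set (F := itr f n) in *. set (D := u - l) in *. assert (HD : 0 < D) by (unfold D; lra).
  assert (HkD : 0 < k * D <= D) by (split; nra).
  pose proof Hnc as (Ha0 & Hax & Hx1 & _).
  destruct (itr_at_distance f c Hf n b x (k * D)) as (h & Hh & Eh);
    [lra|lra|fold F; lra|]. fold F in Eh.
  rewrite Rmin_left, Rmax_right in Hh by lra.
  assert (Hbh : b < h).
  { destruct (Req_dec h b) as [->|]; [|lra]. rewrite Rminus_diag, Rabs_R0 in Eh. lra. }
  assert (Hnch : noncritical f c n a h).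
  { apply (noncritical_sub f c n n a x); try lra; [exact Hnc|lia]. }
  pose proof (noncritical_monotone f c Hf n a h Hnch) as HM. fold F in HM.
  pose proof (koebe_space f c Hf n a q (f c) h Hnch ltac:(lra) ltac:(lra) ltac:(lra)) as KS.
  fold F in KS.
  assert (Hb2 : Rabs (F h - F a) = D + k * D /\ k * D <= Rabs (F h - F (f c))).
  { destruct HM as [M|M]; pose proof (M b h ltac:(lra) ltac:(lra) ltac:(lra));
      pose proof (M (f c) b ltac:(lra) ltac:(lra) ltac:(lra));
      pose proof (M a (f c) ltac:(lra) ltac:(lra) ltac:(lra)).
    - rewrite Rabs_right in Eh by lra. rewrite !Rabs_right by lra. unfold D in *. lra.
    - rewrite Rabs_left in Eh by lra. rewrite !Rabs_left by lra. unfold D in *. lra. }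
  destruct Hb2 as [Hb2 Hb3]. rewrite Hb2 in KS.
  assert (P1 : (f c - q) * (k * D * (m0 * D))
               <= (f c - q) * (Rabs (F h - F (f c)) * Rabs (F q - F a))).
  { apply Rmult_le_compat_l; [lra|].
    assert (0 < m0 * D) by (apply Rmult_lt_0_compat; lra).
    apply Rmult_le_compat; lra. }
  assert (P2 : Rabs (F (f c) - F q) * (D + k * D) * (q - a)
               <= m0 * k / 8 * D * (2 * D) * (q - a)).
  { apply Rmult_le_compat_r; [lra|].
    apply Rmult_le_compat; [apply Rabs_pos|lra|exact Hclose|lra]. }
  assert (0 < m0 * k * D * D) by (repeat apply Rmult_lt_0_compat; lra).
  assert (4 * (f c - q) <= q - a); [|lra].
  apply (Rmult_le_reg_r (m0 * k * D * D)); [assumption|]. lra.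
Qed.

End TransferRanges.

(** * Choice of constants and final case distinction *)

Section Final.
Context (f : R -> R) (c : R) (Hf : S_unimodal f c).
Context (Hrec : recurrent f c) (Hper : ~ periodic_pt f c).

Lemma central_level_after_exit v l u n a b l' u' n' a' b' q :
  nice_level f c v -> fibre f c v l u -> first_return f c v n ->
  return_branch f c v l u n a b -> itr f (S n) (f c) < a ->
  fibre f c a l' u' -> first_return f c a n' -> return_branch f c a l' u' n' a' b' ->
  q < f c -> itr f (S n) q = a -> q <= a'.
Proof.
  intros Hv HF Hr Hb Hnc HFa Hra Hba Hqc Hq. apply Rnot_lt_le. intros L.
  pose proof (return_branch_nice f c v l u n a b Hv HF Hb) as [Ha Hna].
  pose proof (critical_value_range f c Hf).
  assert (Hn : (n < n')%nat).
  { destruct (le_lt_dec n' n) as [L'|]; [exfalso|assumption]. destruct Hra as [Hra _].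
    destruct (Nat.eq_dec n' n) as [->|]; [lra|].
    destruct Hr as [_ Hr]. specialize (Hr (S n') ltac:(lia) ltac:(lia)).
    destruct Hb as (Hva & _). lra. }
  destruct Hba as (Haa & Hac & Hcb & _ & Hin & _).
  assert (K : a < itr f (S n') q).
  { rewrite itr_S. apply (fibre_lt f c Hf a l' u' _ HFa); [apply (itr_range f c Hf); lra|].
    apply Hin. lra. }
  replace (S n') with ((n' - n) + S n)%nat in K by lia. rewrite itr_add, Hq in K.
  specialize (Hna (n' - n)%nat ltac:(lia)). lra.
Qed.

Context (N : nat) (HN : forall p, renormalizable_with_period f c p -> (p <= N)%nat).

Lemma small_transfer_range :
  exists delta, 0 < delta /\ forall e, 0 < e -> exists y, nice f c y /\
    scaled_nbhd delta (U_ f c y) (V_ f c y) /\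
    forall t, is_tau f c y t -> Rabs (y - t) < e.
Proof.
  pose proof (c_range f c Hf) as Hc. pose proof (critical_value_range f c Hf) as Hc1.
  destruct (power_law_exists f c Hf) as (r & m & M & alpha & psi & HP).
  assert (Hm : 0 < m <= M) by (split; apply HP).
  assert (Hr0 : 0 < r /\ r <= c /\ r <= 1 - c) by (split; [|split]; apply HP).
  set (m0 := m / (m + M)).
  assert (Hm0 : 0 < m0).
  { apply Rmult_lt_0_compat; [lra|]. apply Rinv_0_lt_compat. lra. }
  destruct (drop_slightly_outside f c Hf r m M alpha psi HP (/ 9) ltac:(lra)) as (k1 & Hk1 & Hdrop).
  set (k := Rmin k1 (/ 4)).
  assert (Hk : 0 < k <= / 4) by (split; [apply Rmin_glb_lt; lra|apply Rmin_r]).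
  assert (Hkk1 : k <= k1) by apply Rmin_l.
  (* The tolerance matches the two absurdity lemmas with [k / 2], the space guaranteed on either
     side. *)
  destruct (thin_annulus f c Hf r m M alpha psi HP (m0 * (k / 2) / 8)) as (t1 & Ht1 & Hthin).
  { assert (0 < m0 * (k / 2)) by (apply Rmult_lt_0_compat; lra). lra. }
  (* The cap 1 gives [f c - v < 2 * (f c - a)] and, at the next level, [q - a < f c - q]. *)
  set (t := Rmin t1 1).
  assert (Ht : 0 < t <= 1) by (split; [apply Rmin_glb_lt; lra|apply Rmin_r]).
  assert (Htt1 : t <= t1) by apply Rmin_l.
  destruct (thick_annulus f c Hf r m M alpha psi HP t ltac:(lra)) as (delta & Hdel & Hthick).
  exists delta. split; [exact Hdel|]. intros e He.
  destruct (critical_orbit_far f c Hper (S N)) as (d & Hd & Hfar).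
  (* Within [rho] of [c] an interval is shorter than [2 * rho], so enlarging it by its length on
     both sides stays within [3 * rho]. *)
  set (rho := Rmin (Rmin r d) e / 3).
  assert (Hrho : 0 < rho /\ 3 * rho <= r /\ 3 * rho <= d /\ 3 * rho <= e).
  { unfold rho. pose proof (Rmin_l (Rmin r d) e). pose proof (Rmin_r (Rmin r d) e).
    pose proof (Rmin_l r d). pose proof (Rmin_r r d).
    assert (0 < Rmin (Rmin r d) e) by (repeat apply Rmin_glb_lt; lra). lra. }
  destruct Hrho as (P0 & P1 & P2 & P3).
  destruct (small_levels f c Hf rho P0) as (v0 & Hv0 & Hsmall).
  assert (Hsm : forall w l u, v0 < w -> fibre f c w l u -> c - rho < l /\ u < c + rho).
  { intros w l u Hw (H1 & H2 & H3 & H4 & H5 & H6).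
    pose proof (Hsmall l ltac:(lra) ltac:(lra)). pose proof (Hsmall u ltac:(lra) ltac:(lra)). lra. }
  assert (Hfinish : forall w l u n a b, v0 < w -> nice_level f c w -> fibre f c w l u ->
    return_branch f c w l u n a b -> (1 + t) * (f c - a) <= f c - w ->
    exists y, nice f c y /\ scaled_nbhd delta (U_ f c y) (V_ f c y) /\
      forall t, is_tau f c y t -> Rabs (y - t) < e).
  { intros w l u n a b Hw Hn HF Hb Hd'. destruct (Hsm w l u Hw HF) as [S1 S2].
    exists u. split; [exact (nice_fibre f c Hf w l u Hn HF)|]. split.
    - destruct (fibre_exists f c Hf a) as (l' & u' & HFa).
      { apply (return_branch_nice f c w l u n a b Hn HF Hb). }
      exists l, l', u', u. split; [intros y; apply (V_fibre f c Hf w), HF|].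
      split; [intros y; exact (U_fibre f c Hf w l u n a b l' u' y Hn HF Hb HFa)|].
      pose proof HFa as (_ & ? & ? & _). split; [lra|].
      destruct (Hthick w l u a l' u') as [K1 K2]; try assumption.
      + unfold near. destruct HF as (? & ? & ? & _). lra.
      + unfold near. destruct HF as (? & ? & ? & _). lra.
      + apply Hb.
      + split; assumption.
    - intros s Hs. apply (is_tau_fibre f c Hf w l u s HF) in Hs. subst s.
      destruct HF as (? & ? & ? & _). rewrite Rabs_right; lra. }
  destruct (small_noncentral_level f c Hf Hrec Hper N v0 HN Hv0)
    as (v & n & l & u & a & b & Hv & HnN & Hnice & Hr & HF & Hb & Hnc).
  pose proof (return_branch_nice f c v l u n a b Hnice HF Hb) as Ha.
  destruct (fibre_exists f c Hf a (proj1 Ha)) as (l' & u' & HFa).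
  destruct (first_return_exists f c Hf Hrec a (proj1 Ha)) as (n' & Hra).
  destruct (return_branch_exists f c Hf a l' u' n' Ha HFa Hra) as (a' & b' & Hba).
  pose proof Hb as (Hva & Hac & Hcb & Hnca & Hin & Hend & _).
  destruct (Rle_lt_dec ((1 + t) * (f c - a)) (f c - v)) as [L1|L1].
  { exact (Hfinish v l u n a b Hv Hnice HF Hb L1). }
  destruct (Rle_lt_dec ((1 + t) * (f c - a')) (f c - a)) as [L2|L2].
  { exact (Hfinish a l' u' n' a' b' ltac:(lra) Ha HFa Hba L2). }
  exfalso.
  destruct (Hsm v l u Hv HF) as [S1 S2].
  pose proof HF as (F1 & F2 & F3 & F4 & F5 & F6).
  pose proof HFa as (G1 & G2 & G3 & G4 & G5 & G6).
  pose proof (fibre_level f c Hf v l u HF) as Hv1.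
  assert (Nl : near c r l) by (unfold near; lra). assert (Nu : near c r u) by (unfold near; lra).
  destruct (Hthin v l u a l' u' HF HFa Nl Nu Hva) as [T1 T2].
  { assert ((1 + t) * (f c - a) <= (1 + t1) * (f c - a)) by (apply Rmult_le_compat_r; lra). lra. }
  pose proof (fibre_balanced f c r m M alpha psi HP v l u HF Nl Nu) as Hbal. fold m0 in Hbal.
  set (D := u - l) in *. assert (HD : 0 < D) by (unfold D; lra).
  assert (HkD : 0 < k * D <= D / 4) by (split; [apply Rmult_lt_0_compat; lra|nra]).
  assert (Hdr : forall x, l - k * D <= x <= u + k * D -> f c - f x <= (1 + / 9) * (f c - v)).
  { intros x Hx. assert (k * D <= k1 * D) by (apply Rmult_le_compat_r; lra).
    apply (Hdrop v l u x HF Nl Nu); [|fold D; lra]. unfold near, D in *. lra. }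
  assert (Hfar' : forall i, (1 <= i)%nat -> (i <= S N)%nat -> ~ (l - D <= itr f i c <= u + D)).
  { intros i H1 H2 K. specialize (Hfar i H1 H2). unfold D in K.
    apply Rle_not_lt in Hfar. apply Hfar. apply Rabs_def1; lra. }
  assert (HthinP : f c - v < 2 * (f c - a)) by nra.
  pose proof (Hin (f c) ltac:(lra)) as Hcr.
  assert (Hcra : ~ (l' < itr f n (f c) < u')).
  { intros K. apply (fibre_lt f c Hf a l' u' _ HFa) in K; [|apply (itr_range f c Hf), Hc1].
    rewrite <- itr_S in K. lra. }
  destruct (space_right f c Hf Hrec Hper N HN v l u n Hnice HF Hr
    ltac:(unfold D in *; lra) ltac:(unfold D in *; lra) Hfar' k Hk Hdr a b Hb)
    as (xr & Hxr & Hncr & Hspr).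
  destruct (space_left f c Hf Hrec Hper N HN v l u n Hnice HF Hr
    ltac:(unfold D in *; lra) ltac:(unfold D in *; lra) Hfar' k Hk Hdr a b Hb)
    as (xl & Hxl & Hncl & Hspl).
  fold D in Hspr, Hspl.
  assert (Hlow : (itr f n a = u /\ c < itr f n (f c)) \/ (itr f n a = l /\ itr f n (f c) < c) ->
    Rabs (itr f n (f c) - itr f n a) <= m0 * (k / 2) / 8 * D -> False).
  { apply (low_return_absurd f c Hf Hrec Hper v l u n a b HF Hb (k / 2) m0
      ltac:(lra) Hm0 Hbal xl Hxl Hncl Hspl); [|exact HthinP].
    intros x Hx. apply Hdr. fold D in Hx. lra. }
  assert (Hhigh : forall q, a <= q <= f c -> (itr f n q = l' \/ itr f n q = u') ->
    m0 * D <= Rabs (itr f n q - itr f n a) ->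
    Rabs (itr f n (f c) - itr f n q) <= m0 * (k / 2) / 8 * D -> False).
  { intros q Hq Eq K1 K2.
    assert (E : itr f (S n) q = a).
    { rewrite itr_S. destruct Eq as [-> | ->]; assumption. }
    assert (Hqa : a <> q).
    { intros <-. rewrite Rminus_diag, Rabs_R0 in K1. nra. }
    assert (Hqc : q <> f c) by (intros ->; lra).
    pose proof (central_level_after_exit v l u n a b l' u' n' a' b' q Hnice HF Hr Hb Hnc
      HFa Hra Hba ltac:(lra) E) as Hqa'.
    apply (high_return_absurd f c Hf v l u n a b HF Hb (k / 2) m0
      ltac:(lra) Hm0 xr q Hxr Hncr Hspr); [lra| |exact K1|exact K2].
    assert (t * (f c - a') <= f c - a') by (rewrite <- (Rmult_1_l (f c - a')) at 2;
      apply Rmult_le_compat_r; destruct Hba as (? & ? & _); lra). lra. }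
  (* The critical return lies in one of the two thin gaps. The case is low if this gap adjoins
     [itr f n a], high if it lies at the other end. *)
  destruct (Rle_lt_dec u' (itr f n (f c))) as [R|R]; destruct Hend as [[Ea Eb]|[Ea Eb]].
  - destruct (itr_ivt f c Hf n a (f c) u') as (q & Hq & Eq); [lra|lra|lra|left; lra|].
    apply (Hhigh q Hq (or_intror Eq)); rewrite Eq.
    + rewrite Ea, Rabs_right; unfold D in *; lra.
    + rewrite Rabs_right; lra.
  - apply Hlow; [left; lra|]. rewrite Ea, Rabs_left; lra.
  - apply Hlow; [right; lra|]. rewrite Ea, Rabs_right; lra.
  - destruct (itr_ivt f c Hf n a (f c) l') as (q & Hq & Eq); [lra|lra|lra|right; lra|].
    apply (Hhigh q Hq (or_introl Eq)); rewrite Eq.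
    + rewrite Ea, Rabs_left; unfold D in *; lra.
    + rewrite Rabs_left1; lra.
Qed.

End Final.

Theorem theorem3p4 (f : R -> R) (c : R) :
  S_unimodal f c ->
  finitely_renormalizable f c ->
  recurrent f c ->
  ~ periodic_pt f c ->
  exists (delta : R) (y : nat -> R),
    0 < delta /\
    (forall n, nice f c (y n)) /\
    (forall n, scaled_nbhd delta (U_ f c (y n)) (V_ f c (y n))) /\
    (forall eps, 0 < eps -> exists N : nat, forall n, (N <= n)%nat ->
       forall t, is_tau f c (y n) t -> Rabs (y n - t) < eps).
Proof.
  intros Hf [N HN] Hrec Hper.
  destruct (small_transfer_range f c Hf Hrec Hper N HN) as (delta & Hd & H).
  set (y := fun n : nat => proj1_sig (constructive_indefinite_description _
                             (H (/ INR (S n)) (Rinv_0_lt_compat _ (lt_0_INR (S n) (Nat.lt_0_succ n)))))).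
  assert (Hy : forall n, nice f c (y n) /\ scaled_nbhd delta (U_ f c (y n)) (V_ f c (y n)) /\
                 forall t, is_tau f c (y n) t -> Rabs (y n - t) < / INR (S n)).
  { intros n. unfold y. destruct (constructive_indefinite_description _ _) as [z Hz]. exact Hz. }
  exists delta, y. split; [exact Hd|]. split; [intros n; apply Hy|]. split; [intros n; apply Hy|].
  intros eps He. destruct (archimed_cor1 eps He) as (K & HK & HK0).
  exists K. intros n Hn t Ht. destruct (Hy n) as (_ & _ & Hlt). specialize (Hlt t Ht).
  assert (/ INR (S n) <= / INR K); [|lra].
  apply Rinv_le_contravar; [apply lt_0_INR; lia|apply le_INR; lia].
Qed.
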